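(* For a separable Banach space $X$, the following are equivalent: (i) $X$ embeds isomorphically into $c_0$. (ii) There is a bounded function $\mu:B_{X^*}\to\mathbb{R}$ such that $\liminf_{n\to\infty}\mu(x^*+x^*_n)\ge\mu(x^* )+\liminf_{n\to\infty}\|x^*_n\|$ whenever $x^*\in B_{X^*}$, $x^*+x^*_n\in B_{X^*}$ for all $n$, and $(x^*_n)$ is weak$^*$-null. (iii) There is a bounded function $\pi:B_{X^*}\to\mathbb{R}$ such that $\pi(x^* )\ge\mathrm{ca}(x^*_n)+\liminf_{n\to\infty}\pi(x^*+x^*_n)$ whenever $x^*\in B_{X^*}$, $x^*+x^*_n\in B_{X^*}$ for all $n$, and $(x^*_n)$ is weak$^*$-null. (iv) $\pi^\alpha_X<\infty$ on $B_{X^*}$ for every countable ordinal $\alpha<\omega_1$, where $\pi^0_X\equiv0$, $\pi^{\alpha+1}_X(x^* )=\sup\{\mathrm{ca}(x^*_n)+\liminf_{n\to\infty}\pi^\alpha_X(x^*+x^*_n): x^*+x^*_n\in B_{X^*}\text{ for all }n,\ x^*_n\to0\text{ weak}^*\}$, and $\pi^\beta_X(x^* )=\lim_{\alpha\nearrow\beta}\pi^\alpha_X(x^* )$ for limit ordinals $\beta$.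
   Context: $B_{X^*}$ is the closed unit ball of the dual $X^*$. For a bounded sequence $(x_n)$ in a Banach space, $\mathrm{ca}(x_n)=\inf_{m\in\mathbb{N}}\mathrm{diam}\{x_n:n\ge m\}$. The functions $\pi^\alpha_X$ take values in $[0,\infty]$. *)

(* Defs.v *)
From HB Require Import structures.
From mathcomp Require Import all_boot all_order all_algebra.
From mathcomp Require Import all_classical all_reals all_analysis.
Set Implicit Arguments. Unset Strict Implicit. Unset Printing Implicit Defensive.
Import Order.TTheory GRing.Theory Num.Theory.
Import numFieldNormedType.Exports.
Local Open Scope classical_set_scope.
Local Open Scope ring_scope.

Section Dual.
Variables (R : realType) (X : normedModType R).

Definition separable : Prop :=
  exists D : set X, countable D /\ closure D = [set: X].

(* Elements of the dual X^*: continuous linear functionals X -> R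
   (represented as plain functions, so that X^* inherits the pointwise
   vector operations of X -> R). *)
Definition is_dual (f : X -> R) : Prop :=
  (forall (a : R) (x y : X), f (a *: x + y) = a * f x + f y) /\ continuous f.

Definition dnorm (f : X -> R) : R :=
  sup [set `|f x| | x in [set x : X | `|x| <= 1]].

Definition dual_ball : set (X -> R) := [set f | is_dual f /\ dnorm f <= 1].

Definition weakstar_null (xs : nat -> X -> R) : Prop :=
  forall x : X, (fun n => xs n x) @ \oo --> 0.

Definition tail_diam (xs : nat -> X -> R) (m : nat) : R :=
  sup [set dnorm (xs ij.1 - xs ij.2)
      | ij in [set ij : nat * nat | (m <= ij.1)%N /\ (m <= ij.2)%N]].

Definition ca (xs : nat -> X -> R) : R := inf (range (tail_diam xs)).

Local Open Scope ereal_scope.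

Definition pi_step (P : (X -> R) -> \bar R) (f : X -> R) : \bar R :=
  ereal_sup [set (ca xs)%:E + limn_einf (fun n => P (f + xs n)%R)
            | xs in [set xs : nat -> X -> R |
                     weakstar_null xs /\ (forall n, dual_ball (f + xs n)%R)]].

Definition from_below (W : Type) (lt : W -> W -> Prop) (w : W) : set_system W :=
  filter_from [set u | lt u w] (fun u => [set v | lt u v /\ lt v w]).

(* P : W -> B_{X^*} -> [0, oo] is the family (pi^alpha_X)_alpha indexed by the
   well-order (W, lt): P w = pi^alpha_X where alpha is the order type of
   {v | lt v w}.  These are exactly the defining equations of pi^alpha_X. *)
Definition pi_family (W : Type) (lt : W -> W -> Prop)
    (P : W -> (X -> R) -> \bar R) : Prop :=
  forall (w : W) (f : X -> R), dual_ball f ->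
    [/\
        (forall v, ~ lt v w) -> P w f = 0,
        (forall v, lt v w -> (forall u, ~ (lt v u /\ lt u w)) ->
           P w f = pi_step (P v) f) &
        ((exists v, lt v w) -> (forall v, lt v w -> exists u, lt v u /\ lt u w) ->
           (fun v => P v f) @ from_below lt w --> P w f)].
End Dual.

(* Main.v *)
(** The weak-star topology of the dual ball [B] is read off a dense sequence, and
    both (ii) and (iii) amount to the local condition, called [lkk] below, that
    [mu g >= mu f + |g - f| - e] for all [g] in [B] weak-star close to [f]:
    take [pi = -2 mu] in one direction and [mu = - pi] in the other.

    (i) -> (ii): extend functionals from [T X] by Hahn-Banach, so that every [f] in
    [B] is [sum_i a_i T_i] with [a] in l_1; [mu] is a multiple of the least l_1 norm
    of such an [a].

    (ii) -> (i): choose finite nets [S_k] of [B], fine enough that each [g] in [B]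
    is the weak-star limit of a path [f_k] in [S_k] along which [lkk] holds with
    errors [2^-k].  As [mu] is bounded, [sum_k |f_(k+1) - f_k|] telescopes to a
    bound independent of [g].  The normalised differences of members of
    consecutive nets thus form a weak-star null sequence whose l_1 span absorbs [B].

    (iv) -> (iii): [pi_step P] is weak-star upper semicontinuous for every [P], so by
    hereditary separability the increasing iterates stabilise at a countable
    stage; the fixed point is finite and upper semicontinuous on a compact set,
    hence bounded. *)
Require Import Defs.
From HB Require Import structures.
From mathcomp Require Import all_boot all_order all_algebra.
From mathcomp Require Import all_classical all_reals all_analysis.
From mathcomp Require Import zify ring lra.
Import Order.TTheory GRing.Theory Num.Theory.
Import numFieldNormedType.Exports.
Local Open Scope classical_set_scope.
Local Open Scope ring_scope.
Set Implicit Arguments.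
Unset Strict Implicit.
Unset Printing Implicit Defensive.

(** * The Hahn-Banach theorem by way of minimal sublinear maps *)

Section HahnBanach.
Variables (R : realType) (V : lmodType R).

Definition sublinear (p : V -> R) : Prop :=
  (forall x y, p (x + y) <= p x + p y) /\
  (forall t x, 0 <= t -> p (t *: x) <= t * p x).

Lemma sublinear_geN p x : sublinear p -> - p (- x) <= p x.
Proof.
move=> [pD pZ]; have := pD x (- x); rewrite subrr.
have := pD 0 0; rewrite addr0; lra.
Qed.

(** It suffices that sums and multiples of members be dominated by some other member; the lower
    bound keeps the infimum finite. This serves for chains, for lowering along a ray and for
    absorbing a subspace. *)
Lemma sublinear_inf (I : Type) (D : set I) (s : I -> V -> R) (p : V -> R) :
  D !=set0 -> (forall i x, D i -> - p (- x) <= s i x) ->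
  (forall i j x y, D i -> D j ->
     exists2 k, D k & s k (x + y) <= s i x + s j y) ->
  (forall i t x, D i -> 0 <= t -> exists2 k, D k & s k (t *: x) <= t * s i x) ->
  sublinear (fun x => inf [set s i x | i in D]).
Proof.
move=> [i0 Di0] lbp sD sZ.
have hl x : has_lbound [set s i x | i in D].
  by exists (- p (- x)) => _ [i Di <-]; exact: lbp.
have hi x : has_inf [set s i x | i in D].
  by split => //; exists (s i0 x), i0.
split=> [x y|t x t0].
- apply/ler_addgt0Pr => e e0.
  have e20 : 0 < e / 2 by rewrite divr_gt0.
  have [_ [i Di <-] hsi] := inf_adherent e20 (hi x).
  have [_ [j Dj <-] hsj] := inf_adherent e20 (hi y).
  have [k Dk hk] := sD i j x y Di Dj.
  have : inf [set s i (x + y) | i in D] <= s k (x + y) by apply: ge_inf => //; exists k.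
  lra.
- have [->|tn0] := eqVneq t 0.
    have [k Dk] := sZ i0 0 x Di0 (lexx _); rewrite !mul0r => hk.
    by apply: le_trans hk; apply: ge_inf => //; exists k.
  have tp : 0 < t by rewrite lt_neqAle eq_sym tn0.
  rewrite -ler_pdivrMl //; apply: lb_le_inf; first by exists (s i0 x), i0.
  move=> _ [i Di <-]; rewrite ler_pdivrMl //.
  have [k Dk hk] := sZ i t x Di t0.
  by apply: le_trans hk; apply: ge_inf => //; exists k.
Qed.

Lemma minimal_sublinear (p : V -> R) : sublinear p ->
  exists q, [/\ sublinear q, forall x, q x <= p x &
    forall r, sublinear r -> (forall x, r x <= q x) -> r = q].
Proof.
move=> slp.
pose T := {q : V -> R | sublinear q /\ forall x, q x <= p x}.
(* The order is reversed, so that the maximal element given by Zorn's lemma is a minimal sublinear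
   map. *)
pose Rel (a b : T) := `[< forall x, sval b x <= sval a x >].
have [|a b c /asboolP ab /asboolP bc|a b /asboolP ab /asboolP ba|A totA|[q [slq qp]] hq] :=
    @Zorn T Rel.
- by move=> a; apply/asboolP.
- by apply/asboolP => x; apply: le_trans (bc x) (ab x).
- case: a b ab ba => [a Ha] [b Hb] /= ab ba; apply: eq_exist.
  by apply/funext => x; apply/eqP; rewrite eq_le ab ba.
- have [[a0 Aa0]|A0] := pselect (A !=set0); last first.
    exists (exist _ p (conj slp (fun x => lexx _))) => s As.
    by exfalso; apply: A0; exists s.
  have lb (i : T) x : A i -> - p (- x) <= sval i x.
    move=> _; case: i => q [slq qp] /=.
    by apply: le_trans (sublinear_geN x slq); rewrite lerN2.
  have slA : sublinear (fun x => inf [set sval i x | i in A]).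
    apply: (@sublinear_inf _ _ _ p) => //; first by exists a0.
    + move=> i j x y Ai Aj; have [/asboolP h|/asboolP h] := totA i j Ai Aj.
      * exists j => //; case: j {Aj} h => j [[jD ?] ?] /= h.
        by apply: le_trans (jD _ _) _; rewrite lerD2r.
      * exists i => //; case: i {Ai} h => i [[iD ?] ?] /= h.
        by apply: le_trans (iD _ _) _; rewrite lerD2l.
    + by move=> i t x Ai t0; exists i => //; case: i {Ai} => i [[? iZ] ?]; exact: iZ.
  have Ap x : inf [set sval i x | i in A] <= p x.
    apply: le_trans (_ : sval a0 x <= p x); last by case: (a0) => q [].
    by apply: ge_inf; [exists (- p (- x)) => _ [i Ai <-]; exact: lb|exists a0].
  exists (exist (fun q : V -> R => sublinear q /\ forall x, q x <= p x) _ (conj slA Ap)).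
  move=> s As; apply/asboolP => x /=.
  by apply: ge_inf; [exists (- p (- x)) => _ [i Ai <-]; exact: lb|exists s].
- exists q; split=> // r slr rq.
  have rp x : r x <= p x by apply: le_trans (rq x) (qp x).
  have := hq (exist _ r (conj slr rp)).
  by move=> /(_ (asboolT rq)) /(congr1 sval).
Qed.

Lemma minimal_sublinear_linear (q : V -> R) : sublinear q ->
  (forall r, sublinear r -> (forall x, r x <= q x) -> r = q) ->
  forall a x y, q (a *: x + y) = a * q x + q y.
Proof.
move=> slq qmin; have [qD qZ] := slq.
have q0 : q 0 = 0.
  apply/eqP; rewrite eq_le; apply/andP; split.
    by have := qZ 0 0 (lexx _); rewrite scale0r mul0r.
  by have := qD 0 0; rewrite addr0 -subr_ge0 addrK.
(* Lowering [q] along the ray of [y] gives a sublinear map below [q]; minimality makes it [q]. *)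
have qDge x y : q x + q y <= q (x + y).
  pose r x := inf [set q (x + t *: y) - t * q y | t in [set t : R | 0 <= t]].
  have lb (t : R) z : 0 <= t -> - q (- z) <= q (z + t *: y) - t * q y.
    move=> t0; have := qD (z + t *: y) (- z); rewrite addrAC subrr add0r.
    suff : t * q y <= q (t *: y) by lra.
    have [->|tn0] := eqVneq t 0; first by rewrite scale0r q0 mul0r.
    have tp : 0 < t by rewrite lt_neqAle eq_sym tn0.
    have ti : 0 <= t^-1 by rewrite invr_ge0.
    by have := qZ t^-1 (t *: y) ti; rewrite scalerA mulVf // scale1r ler_pdivlMl.
  have slr : sublinear r.
    apply: (@sublinear_inf _ _ _ q).
    - by exists 0 => /=.
    - by move=> t z; exact: lb.
    - move=> s t z w /= s0 t0; exists (s + t); first exact: addr_ge0.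
      by have := qD (z + s *: y) (w + t *: y); rewrite addrACA -scalerDl; lra.
    - move=> s t z /= s0 t0; exists (t * s); first exact: mulr_ge0.
      by rewrite -scalerA -scalerDr mulrBr -mulrA lerD2r; exact: qZ.
  have rq z : r z <= q (z + 1 *: y) - 1 * q y.
    by apply: ge_inf; [exists (- q (- z)) => _ [t /= t0 <-]; exact: lb|exists 1 => /=].
  have rq0 z : r z <= q z.
    apply: ge_inf; first by exists (- q (- z)) => _ [t /= t0 <-]; exact: lb.
    by exists 0 => //=; rewrite scale0r mul0r addr0 subr0.
  by have := rq x; rewrite (qmin r slr rq0) scale1r mul1r lerBrDr.
have qadd x y : q (x + y) = q x + q y by apply/eqP; rewrite eq_le qD qDge.
have qN x : q (- x) = - q x.
  by apply/eqP; rewrite -subr_eq0 opprK -qadd addNr q0.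
have qZp t x : 0 <= t -> q (t *: x) = t * q x.
  move=> t0; apply/eqP; rewrite eq_le qZ //=.
  by rewrite -lerN2 -qN -scalerN -mulrN -qN qZ.
move=> a x y; rewrite qadd; congr (_ + _).
have [a0|a0] := leP 0 a; first exact: qZp.
rewrite -[a]opprK scaleNr qN qZp ?mulNr //.
by rewrite oppr_ge0 ltW.
Qed.

(** The subspace enters as the image of a linear map [i], which avoids subtypes. A minimal sublinear
    map below [x |-> inf_u (p (x + i u) - f u)] is linear and at most [f] on the image; passing from
    [u] to [- u] turns this into equality. *)
Theorem hahn_banach (U : lmodType R) (p : V -> R) (i : U -> V) (f : U -> R) :
  sublinear p -> (forall a x y, i (a *: x + y) = a *: i x + i y) ->
  (forall a x y, f (a *: x + y) = a * f x + f y) ->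
  (forall u, f u <= p (i u)) ->
  exists F : V -> R, [/\ forall a x y, F (a *: x + y) = a * F x + F y,
    forall x, F x <= p x & forall u, F (i u) = f u].
Proof.
move=> slp il fl fp; have [pD pZ] := slp.
have f0 : f 0 = 0.
  by have := fl 1 0 0; rewrite scaler0 addr0 mul1r; lra.
have i0 : i 0 = 0.
  have := il 1 0 0; rewrite !scale1r addr0 => /eqP.
  by rewrite -subr_eq subrr eq_sym => /eqP.
have fD u v : f (u + v) = f u + f v by have := fl 1 u v; rewrite scale1r mul1r.
have iD u v : i (u + v) = i u + i v by have := il 1 u v; rewrite !scale1r.
have iN u : i (- u) = - i u.
  by have := il (-1) u 0; rewrite !addr0 i0 addr0 !scaleN1r.
have fN u : f (- u) = - f u.
  by have := fl (-1) u 0; rewrite addr0 f0 addr0 scaleN1r mulN1r.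
have lb u x : - p (- x) <= p (x + i u) - f u.
  by have := fp u; have := pD (x + i u) (- x); rewrite addrAC subrr add0r; lra.
have slr : sublinear (fun x => inf [set p (x + i u) - f u | u in [set: U]]).
  apply: (@sublinear_inf _ _ _ p).
  - by exists 0.
  - by move=> u x _; exact: lb.
  - move=> u v x y _ _; exists (u + v) => //.
    have := pD (x + i u) (y + i v); rewrite addrACA -iD fD; lra.
  - move=> u t x _ t0; exists (t *: u) => //.
    have -> : i (t *: u) = t *: i u by rewrite -[t *: u]addr0 il i0 addr0.
    have -> : f (t *: u) = t * f u by rewrite -[t *: u]addr0 fl f0 addr0.
    by rewrite -scalerDr mulrBr lerD2r; exact: pZ.
have rle x u : inf [set p (x + i u) - f u | u in [set: U]] <= p (x + i u) - f u.
  by apply: ge_inf; [exists (- p (- x)) => _ [v _ <-]; exact: lb|exists u].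
have [F [slF Fr Fmin]] := minimal_sublinear slr.
have Fl := minimal_sublinear_linear slF Fmin.
have p0 : p 0 <= 0 by have := pZ 0 0 (lexx _); rewrite scale0r mul0r.
have Ff u : F (i u) <= f u.
  apply: le_trans (Fr _) _; apply: le_trans (rle _ (- u)) _.
  by rewrite iN fN subrr opprK; lra.
have F0 : F 0 = 0 by have := Fl 1 0 0; rewrite scaler0 addr0 mul1r; lra.
exists F; split=> // [x|u].
  apply: le_trans (Fr _) _; apply: le_trans (rle _ 0) _.
  by rewrite i0 f0 addr0 subr0.
apply/eqP; rewrite eq_le Ff /=.
have := Ff (- u); rewrite iN fN.
have := Fl (-1) (i u) 0; rewrite F0 !addr0 scaleN1r mulN1r => ->; lra.
Qed.

End HahnBanach.

(** * The dual norm and the dual unit ball *)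

Section DualBall.
Variables (R : realType) (X : normedModType R).
Implicit Types (f g h : X -> R).

Lemma is_dual0 f : is_dual f -> f 0 = 0.
Proof. by move=> [fl _]; have := fl 1 0 0; rewrite scaler0 addr0 mul1r; lra. Qed.

Lemma is_dualN f x : is_dual f -> f (- x) = - f x.
Proof.
move=> fd; have := fd.1 (-1) x 0.
by rewrite (is_dual0 fd) !addr0 scaleN1r mulN1r.
Qed.

Lemma is_dualZ f a x : is_dual f -> f (a *: x) = a * f x.
Proof. by move=> fd; have := fd.1 a x 0; rewrite (is_dual0 fd) !addr0. Qed.

Lemma is_dual_sub f x y : is_dual f -> f (x - y) = f x - f y.
Proof.
by move=> fd; have := fd.1 1 x (- y); rewrite is_dualN // scale1r mul1r.
Qed.

Lemma is_dual_bounded f : is_dual f -> exists2 K, 0 < K & forall x, `|f x| <= K * `|x|.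
Proof.
move=> fd; have : f x @[x --> (0 : X)] --> f 0 := fd.2 0.
rewrite (is_dual0 fd) => /cvgr0Pnorm_lt /(_ 1 ltr01).
move=> /nbhs_ballP [d /= d0 hd]; exists (2 / d); first by rewrite divr_gt0.
move=> x; have [->|x0] := eqVneq x 0.
  by rewrite (is_dual0 fd) !normr0 mulr0.
have nx : 0 < `|x| by rewrite normr_gt0.
have := hd ((d / 2 / `|x|) *: x); rewrite -ball_normE /= sub0r normrN normrZ.
rewrite (is_dualZ _ _ fd) [`|_ * f x|]normrM.
have -> : `|d / 2 / `|x| | = d / 2 / `|x| by rewrite ger0_norm // !divr_ge0 // ltW.
rewrite divfK ?gt_eqF // => /(_ _) h.
have {h} : d / 2 / `|x| * `|f x| < 1 by apply: h; rewrite ltr_pdivrMr //; lra.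
rewrite mulrC mulrA ltr_pdivrMr // mul1r => h.
rewrite mulrAC ler_pdivlMr //; lra.
Qed.

Lemma is_dual_of_bound f K : (forall (a : R) x y, f (a *: x + y) = a * f x + f y) ->
  (forall x, `|f x| <= K * `|x|) -> is_dual f.
Proof.
move=> fl fK; split=> // x.
have fB y z : f (y - z) = f y - f z.
  by have := fl (-1) z y; rewrite scaleN1r mulN1r addrC => ->; rewrite addrC.
apply/cvgrPdist_lt => e e0; have K1 : 0 < `|K| + 1 by rewrite ltr_wpDl.
near=> y; rewrite -fB; apply: le_lt_trans (fK _) _.
apply: (@le_lt_trans _ _ ((`|K| + 1) * `|x - y|)).
  by apply: ler_wpM2r => //; apply: le_trans (ler_norm _) _; rewrite lerDl.
rewrite mulrC -ltr_pdivlMr //; near: y.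
have eK : 0 < e / (`|K| + 1) by rewrite divr_gt0.
by apply: cvgr_dist_lt eK; exact: cvg_id.
Unshelve. all: by end_near. Qed.

Lemma dnorm_le f s : (forall x, `|x| <= 1 -> `|f x| <= s) -> dnorm f <= s.
Proof.
move=> h; apply: ge_sup; first by exists `|f 0|, 0 => //=; rewrite normr0.
by move=> _ [x /= x1 <-]; exact: h.
Qed.

Lemma dnorm_has_sup f : is_dual f -> has_sup [set `|f x| | x in [set x : X | `|x| <= 1]].
Proof.
move=> fd; have [K K0 hK] := is_dual_bounded fd; split.
  by exists `|f 0|, 0 => //=; rewrite normr0.
exists K => _ [x /= x1 <-]; apply: le_trans (hK x) _.
by rewrite -[leRHS]mulr1 ler_pM2l.
Qed.

Lemma dnorm_ge0 f : is_dual f -> 0 <= dnorm f.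
Proof.
move=> fd; apply: le_trans (normr_ge0 (f 0)) _.
by apply: ub_le_sup; [exact: (dnorm_has_sup fd).2|exists 0 => //=; rewrite normr0].
Qed.

Lemma le_dnorm f x : is_dual f -> `|f x| <= dnorm f * `|x|.
Proof.
move=> fd; have [->|x0] := eqVneq x 0.
  by rewrite (is_dual0 fd) !normr0 mulr0.
have nx : 0 < `|x| by rewrite normr_gt0.
rewrite -ler_pdivrMr // mulrC; apply: ub_le_sup; first exact: (dnorm_has_sup fd).2.
exists (`|x|^-1 *: x) => /=; first by rewrite normrZ normfV normr_id mulVf ?gt_eqF.
by rewrite (is_dualZ _ _ fd) normrM normfV normr_id.
Qed.

Lemma lt_dnorm f c : is_dual f -> c < dnorm f -> exists2 x, `|x| <= 1 & c < `|f x|.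
Proof.
move=> fd; rewrite -subr_gt0 => /sup_adherent /(_ (dnorm_has_sup fd)).
by move=> [_ [x /= x1 <-]]; rewrite opprB addrC subrK; exists x.
Qed.

(** This form passes to pointwise limits; continuity is recovered from the bound. *)
Lemma dual_ballP f : dual_ball f <->
  (forall (a : R) x y, f (a *: x + y) = a * f x + f y) /\ (forall x, `|f x| <= `|x|).
Proof.
split=> [[fd f1]|[fl f1]].
  split=> [|x]; first exact: fd.1.
  by apply: le_trans (le_dnorm x fd) _; rewrite ler_piMl.
split; last by apply: dnorm_le => x; exact: le_trans.
by apply: (@is_dual_of_bound _ 1) => // x; rewrite mul1r.
Qed.

Lemma is_dualB f g : is_dual f -> is_dual g -> is_dual (f - g).
Proof.
move=> fd gd; have [K _ hK] := is_dual_bounded fd; have [L _ hL] := is_dual_bounded gd.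
apply: (@is_dual_of_bound _ (K + L)) => [a x y|x] /=.
  have E z : (f - g) z = f z - g z by [].
  by rewrite !E fd.1 gd.1; lra.
apply: le_trans (ler_normB (f x) (g x)) _; rewrite mulrDl; exact: lerD.
Qed.

Lemma dual_ballB_norm f g x : dual_ball f -> dual_ball g -> `|f x - g x| <= dnorm (f - g) * `|x|.
Proof. by move=> [fd _] [gd _]; exact: (le_dnorm x (is_dualB fd gd)). Qed.

Lemma dnormB_ge0 f g : dual_ball f -> dual_ball g -> 0 <= dnorm (f - g).
Proof. by move=> [fd _] [gd _]; exact/dnorm_ge0/is_dualB. Qed.

Lemma dnormB_le2 f g : dual_ball f -> dual_ball g -> dnorm (f - g) <= 2.
Proof.
move=> /dual_ballP[_ f1] /dual_ballP[_ g1]; apply: dnorm_le => x x1.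
apply: le_trans (ler_normB (f x) (g x)) _.
by have := f1 x; have := g1 x; lra.
Qed.

Lemma dnormB_triangle h f g : dual_ball f -> dual_ball g -> dual_ball h ->
  dnorm (f - g) <= dnorm (f - h) + dnorm (g - h).
Proof.
move=> fB gB hB; apply: dnorm_le => x x1.
have -> : (f - g) x = (f x - h x) - (g x - h x) by rewrite -[LHS]/(f x - g x); lra.
apply: le_trans (ler_normB _ _) _; apply: lerD.
  apply: le_trans (dual_ballB_norm x fB hB) _.
  by rewrite ler_piMr // dnormB_ge0.
apply: le_trans (dual_ballB_norm x gB hB) _.
by rewrite ler_piMr // dnormB_ge0.
Qed.

Lemma norming_functional x : exists2 f : X -> R, dual_ball f & f x = `|x|.
Proof.
have [||||F [Fl Fn Fx]] := @hahn_banach R X R^o (fun y => `|y|)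
    (fun r => r *: x) (fun r => r * `|x|).
- split=> [y z|t y t0]; first exact: ler_normD.
  by rewrite normrZ ger0_norm.
- by move=> a r s; rewrite scalerDl scalerA.
- by move=> a r s; rewrite mulrDl mulrA.
- by move=> r; rewrite normrZ ler_wpM2r // ler_norm.
have F0 : F 0 = 0 by have := Fl 1 0 0; rewrite scaler0 addr0 mul1r; lra.
exists F; last by rewrite -[x in LHS]scale1r Fx mul1r.
apply/dual_ballP; split=> // y; rewrite ler_norml Fn andbT lerNl.
by have := Fn (- y); rewrite normrN -scaleN1r -[_ *: _]addr0 Fl F0 addr0 mulN1r.
Qed.

End DualBall.

(** * Limits along ultrafilters and lower limits of extended reals *)

Section Limits.
Variable R : realType.

(** Compactness of a segment. Limits along an ultrafilter replace successive extractions of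
    subsequences and exist for all coordinates at once. *)
Lemma ultra_bounded_cvg (T : Type) (U : set_system T) (u : T -> R) (K : R) :
  UltraFilter U -> (\forall t \near U, `|u t| <= K) -> exists l : R, u @ U --> l.
Proof.
move=> UU uK; have PU : ProperFilter U := @ultra_proper _ U UU.
have [|l [_ cl]] := @segment_compact R (- K) K (u @ U) _.
  by apply: filterS uK => t; rewrite /= in_itv /= ler_norml.
exists l => A lA; have [//|UA] := in_ultra_setVsetC (u @^-1` A) UU.
by have [y []] := cl (~` A) A UA lA.
Qed.

Lemma free_ultrafilter :
  exists U : set_system nat, UltraFilter U /\ forall N, U [set n | (N <= n)%N].
Proof.
have [U [UU hU]] := ultraFilterLemma (eventually_filter : ProperFilter \oo).
by exists U; split=> // N; apply: hU; exists N.
Qed.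

Lemma bounded_cluster (u : nat -> R) (K : R) : (forall n, `|u n| <= K) ->
  exists l : R, forall (e : R) N, 0 < e -> exists2 n, (N <= n)%N & `|l - u n| < e.
Proof.
move=> uK; have [U [UU hU]] := free_ultrafilter.
have PU : ProperFilter U := @ultra_proper _ U UU.
have [|l ul] := @ultra_bounded_cvg _ U u K UU; first exact: nearW.
exists l => e N e0; have /cvgrPdist_lt /(_ e e0) ue := ul.
have [n [Nn en]] := filter_ex (filterI (hU N) ue).
by exists n.
Qed.

Lemma le_limn_einf (u : nat -> \bar R) (l : \bar R) :
  (\forall n \near \oo, (l <= u n)%E) -> (l <= limn_einf u)%E.
Proof.
move=> [N _ hN]; rewrite limn_einf_lim (cvg_lim _ (@cvg_einfs_sup R u)) //.
apply: le_ereal_sup_tmp; exists (einfs u N); first by exists N.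
by apply: le_ereal_inf_tmp => _ [n /= Nn <-]; exact: hN.
Qed.

Lemma lt_limn_einf (u : nat -> \bar R) (l : \bar R) :
  (l < limn_einf u)%E -> \forall n \near \oo, (l < u n)%E.
Proof.
rewrite limn_einf_lim (cvg_lim _ (@cvg_einfs_sup R u)) //.
move=> /ereal_sup_gt[_ [N _ <-] lN]; exists N => // n Nn.
by apply: lt_le_trans lN _; apply: ereal_inf_lbound; exists n.
Qed.

Lemma limn_einf_mono (u v : nat -> \bar R) : (\forall n \near \oo, (u n <= v n)%E) ->
  (limn_einf u <= limn_einf v)%E.
Proof.
move=> [M _ uv]; rewrite !limn_einf_lim !(cvg_lim _ (@cvg_einfs_sup R _)) //.
apply: ge_ereal_sup => _ [N _ <-]; apply: le_ereal_sup_tmp.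
exists (einfs v (maxn M N)); first by exists (maxn M N).
apply: le_ereal_inf_tmp => _ [n /= + <-]; rewrite geq_max => /andP[Mn Nn].
by apply: le_trans (uv n Mn); apply: ereal_inf_lbound; exists n.
Qed.

Lemma limn_einf_le (u : nat -> \bar R) (l : \bar R) :
  (forall n, (u n <= l)%E) -> (limn_einf u <= l)%E.
Proof.
move=> ul; rewrite leNgt; apply/negP => /lt_limn_einf lu.
by have [n] := filter_ex lu; rewrite ltNge ul.
Qed.

End Limits.

(** * The weak-star topology of the dual ball *)

Section Closeness.
Variables (R : realType) (X : normedModType R).
Implicit Types (f g h : X -> R).

Lemma separable_dense_seq : separable X ->
  exists d : nat -> X, forall x (e : R), 0 < e -> exists n, `|x - d n| < e.
Proof.
move=> [D [cD clD]].
have D0 : D !=set0.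
  have : closure D 0 by rewrite clD.
  by move=> /(_ setT filterT)[x [Dx _]]; exists x.
have [x0 Dx0] := D0; have [j jinj] := countable_injP _ cD.
exists (fun n => xget x0 [set x | D x /\ j x = n]) => x e e0.
have : closure D x by rewrite clD.
move=> /(_ _ (nbhsx_ballx x e e0))[y [Dy]]; rewrite -ball_normE /= => xy.
exists (j y); case: xgetP => [z _ [Dz jz]|/(_ y)[]//].
by rewrite (jinj z y) ?inE.
Qed.

Variable d : nat -> X.
Hypothesis dd : forall x (e : R), 0 < e -> exists n, `|x - d n| < e.

(** On the dual ball these relations form a countable base of the weak-star uniformity; one index
    controls both the number of test points and the tolerance. *)
Definition close N f g := forall i, (i <= N)%N -> `|f (d i) - g (d i)| < N.+1%:R^-1.

Lemma close_sym N f g : close N f g -> close N g f.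
Proof. by move=> h i iN; rewrite distrC; exact: h. Qed.

Lemma close_anti M N f g : (M <= N)%N -> close N f g -> close M f g.
Proof.
move=> MN h i iM; apply: lt_le_trans (h _ (leq_trans iM MN)) _.
by rewrite lef_pV2 ?posrE // ler_nat ltnS.
Qed.

(** The tolerance [1 / (2N + 2)] is exactly half of [1 / (N + 1)]. *)
Lemma close_trans N g f h : close N.*2.+1 f g -> close N.*2.+1 g h -> close N f h.
Proof.
move=> fg gh i iN; have iN2 : (i <= N.*2.+1)%N by lia.
have := fg i iN2; have := gh i iN2.
have -> : N.*2.+2%:R = N.+1%:R * 2 :> R by rewrite -natrM; congr _%:R; lia.
rewrite invfM; set r := N.+1%:R^-1 => h1 h2; have := ler_distD (g (d i)) (f (d i)) (h (d i)); lra.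
Qed.

Lemma close_pointwise x e : 0 < e -> exists N, forall f g,
  dual_ball f -> dual_ball g -> close N f g -> `|f x - g x| < e.
Proof.
move=> e0; have e40 : 0 < e / 4 by lra.
(* Moving from [x] to [d i] costs at most [2 * (e / 4)], since [f - g] has norm at most 2; the index
   [m] pays for the value at [d i]. *)
have [i xi] := dd x e40.
have [m _ /(_ m (leqnn _)) /= hm] := near_infty_natSinv_lt (PosNum e40).
exists (maxn i m) => f g fB gB /(_ i (leq_maxl _ _)) hc.
have hm' : (maxn i m).+1%:R^-1 <= m.+1%:R^-1 :> R.
  by rewrite lef_pV2 ?posrE // ler_nat ltnS leq_maxr.
have := dual_ballB_norm (x - d i) fB gB.
rewrite (is_dual_sub _ _ fB.1) (is_dual_sub _ _ gB.1).
have := dnormB_le2 fB gB => h2 h3.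
have h4 : dnorm (f - g) * `|x - d i| <= 2 * (e / 4).
  by apply: ler_pM => //; [exact: dnormB_ge0|exact: ltW].
have := ler_normD (f x - f (d i) - (g x - g (d i))) (f (d i) - g (d i)).
have -> : f x - f (d i) - (g x - g (d i)) + (f (d i) - g (d i)) = f x - g x by lra.
have := le_trans h3 h4; have := lt_trans (lt_le_trans hc hm') hm; lra.
Qed.

Lemma close_weakstar f (xs : nat -> X -> R) : weakstar_null xs ->
  forall N, \forall n \near \oo, close N f (f + xs n).
Proof.
move=> w0 N.
have h (M : nat) : \forall n \near \oo, forall i, (i < M)%N -> `|xs n (d i)| < N.+1%:R^-1.
  elim: M => [|M IH]; first by apply: nearW => n i; rewrite ltn0.
  have N0 : 0 < N.+1%:R^-1 :> R by rewrite invr_gt0.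
  have /cvgr0Pnorm_lt /(_ _ N0) := w0 (d M).
  by apply: filterS2 IH => n h1 h2 i; rewrite ltnS leq_eqVlt => /orP[/eqP ->|/h1].
apply: filterS (h N.+1) => n hn i iN.
by rewrite -[(f + xs n) _]/(f _ + xs n _) opprD addNKr normrN; exact: hn.
Qed.

Lemma weakstar_close f (g : nat -> X -> R) : dual_ball f -> (forall n, dual_ball (g n)) ->
  (forall N, \forall n \near \oo, close N f (g n)) -> weakstar_null (fun n => g n - f).
Proof.
move=> fB gB h x; apply/cvgr0Pnorm_lt => e e0.
have [N hN] := close_pointwise x e0.
by apply: filterS (h N) => n /(hN _ _ fB (gB n)); rewrite distrC.
Qed.

(** Banach-Alaoglu: pointwise limits exist because [|u t x| <= |x|], and linearity and this bound
    survive the limit. *)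
Lemma dual_ball_ultra (T : Type) (U : set_system T) (u : T -> X -> R) :
  UltraFilter U -> (\forall t \near U, dual_ball (u t)) ->
  exists2 f, dual_ball f & forall x, u t x @[t --> U] --> f x.
Proof.
move=> UU uB; have PU : ProperFilter U := @ultra_proper _ U UU.
have /choice[f fl] (x : X) : exists l, u t x @[t --> U] --> (l : R).
  apply: (@ultra_bounded_cvg _ _ _ _ `|x|) => //.
  by apply: filterS uB => t /dual_ballP[_].
exists f => //; apply/dual_ballP; split=> [a x y|x].
- have h : a * u t x + u t y @[t --> U] --> a * f x + f y.
    by apply: cvgD; [apply: cvgMr|]; exact: fl.
  apply: (cvg_unique _ (fl _)); first exact: Rhausdorff.
  apply: cvg_trans h; apply: near_eq_cvg; apply: filterS uB => t /dual_ballP[ul _].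
  by rewrite ul.
- apply: (@closed_cvg _ _ U _ (fun t => `|u t x|) (fun r => r <= `|x|)).
  + exact: closed_le.
  + by apply: filterS uB => t /dual_ballP[_].
  + by apply: cvg_norm; exact: fl.
Qed.

Lemma ultra_close (T : Type) (U : set_system T) (u : T -> X -> R) f N : UltraFilter U ->
  (forall x, u t x @[t --> U] --> f x) -> \forall t \near U, close N f (u t).
Proof.
move=> UU uf; have PU : ProperFilter U := @ultra_proper _ U UU.
have h (M : nat) : \forall t \near U, forall i, (i < M)%N -> `|f (d i) - u t (d i)| < N.+1%:R^-1.
  elim: M => [|M IH]; first by apply: nearW => n i; rewrite ltn0.
  have N0 : 0 < N.+1%:R^-1 :> R by rewrite invr_gt0.
  have /cvgrPdist_lt /(_ _ N0) := uf (d M).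
  by apply: filterS2 IH => n h1 h2 i; rewrite ltnS leq_eqVlt => /orP[/eqP ->|/h1].
by apply: filterS (h N.+1) => t ht i iN; exact: ht.
Qed.

(** Weak-star compactness, for neighbourhoods whose size depends on the centre. Without a finite
    subcover the uncovered sets generate a proper filter; an ultrafilter above it converges to some
    [f] of the ball and yet avoids the neighbourhood of [f]. *)
Lemma dual_ball_cover (N : (X -> R) -> nat) : exists s : seq (X -> R),
  (forall f, f \in s -> dual_ball f) /\
  forall g, dual_ball g -> exists2 f, f \in s & close (N f) f g.
Proof.
apply: contrapT => nos.
pose B (s : seq (X -> R)) :=
  [set g | dual_ball g /\ forall f, f \in s -> dual_ball f -> ~ close (N f) f g].
have FF : Filter (filter_from setT B).
  apply: filter_from_filter; first by exists [::].
  move=> s t _ _; exists (s ++ t) => // g [gB h].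
  by split; split=> // f fs; apply: h; rewrite mem_cat fs ?orbT.
have PF : ProperFilter (filter_from setT B).
  apply: filter_from_proper => s _; apply: contrapT => Bs; apply: nos.
  exists [seq f <- s | `[< dual_ball f >]]; split.
    by move=> f; rewrite mem_filter => /andP[/asboolP].
  move=> g gB; apply: contrapT => h; apply: Bs; exists g; split=> // f fs fB c.
  by apply: h; exists f => //; rewrite mem_filter fs andbT; apply/asboolP.
have [U [UU FU]] := ultraFilterLemma PF.
have PU : ProperFilter U := @ultra_proper _ U UU.
have UB (s : seq (X -> R)) : U (B s) by apply: FU; exists s.
have [|f fB uf] := @dual_ball_ultra _ U id UU; first by apply: filterS (UB [::]) => g [].
have [g [[_ h] c]] := filter_ex (filterI (UB [:: f]) (ultra_close (N f) UU uf)).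
by apply: (h f) c => //; rewrite mem_head.
Qed.

End Closeness.

(** * The operator [pi_step] and its upper semicontinuity *)

Section PiStep.
Variables (R : realType) (X : normedModType R) (d : nat -> X).
Hypothesis dd : forall x (e : R), 0 < e -> exists n, `|x - d n| < e.
Implicit Types (f g h : X -> R) (P : (X -> R) -> \bar R).

Lemma translate_sub f (xs : nat -> X -> R) i j :
  xs i - xs j = (f + xs i) - (f + xs j).
Proof. by rewrite opprD addrACA subrr add0r. Qed.

Lemma tail_diam_has_sup f xs m : (forall n, dual_ball (f + xs n)) ->
  has_sup [set dnorm (xs ij.1 - xs ij.2)
      | ij in [set ij : nat * nat | (m <= ij.1)%N /\ (m <= ij.2)%N]].
Proof.
move=> B; split; first by exists (dnorm (xs m - xs m)), (m, m) => /=.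
by exists 2 => _ [[i j] _ <-] /=; rewrite (translate_sub f); exact: dnormB_le2.
Qed.

Lemma dnorm_le_tail_diam f xs m i j : (forall n, dual_ball (f + xs n)) ->
  (m <= i)%N -> (m <= j)%N -> dnorm (xs i - xs j) <= tail_diam xs m.
Proof.
move=> B mi mj; apply: ub_le_sup; first exact: (tail_diam_has_sup m B).2.
by exists (i, j).
Qed.

Lemma ca_le_tail_diam f xs m : (forall n, dual_ball (f + xs n)) ->
  ca xs <= tail_diam xs m.
Proof.
move=> B; apply: ge_inf; last by exists m.
exists 0 => _ [k _ <-]; apply: le_trans (dnorm_le_tail_diam B (leqnn k) (leqnn k)).
by rewrite (translate_sub f); exact: dnormB_ge0.
Qed.

(** Pairs near [f] replace weak-star null sequences: for [f] in the ball, [pi_step P f] is the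
    supremum of [c + l] over all spreads, by the next two lemmas. *)
Definition spread P f (c l : R) := forall N, exists g h,
  [/\ dual_ball g, dual_ball h, close d N f g, close d N f h &
      [/\ (l%:E <= P g)%E, (l%:E <= P h)%E & c <= dnorm (g - h)]].

Lemma pi_step_ge P f c l : dual_ball f -> spread P f c l ->
  ((c + l)%:E <= pi_step P f)%E.
Proof.
move=> fB /choice[g /choice[h H]].
(* Interleaving puts [g n] and [h n] at positions [2n] and [2n + 1], so that every tail contains a
   pair at distance at least [c]. *)
pose G n := if odd n then h n./2 else g n./2.
have GB n : dual_ball (G n) by rewrite /G; case: ifP => _; case: (H n./2).
have fG n : f + (G n - f) = G n by rewrite addrC subrK.
have fGB n : dual_ball (f + (G n - f)) by rewrite fG.
apply: le_ereal_sup_tmp.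
exists ((ca (fun n => G n - f))%:E + limn_einf (fun n => P (f + (G n - f))%R))%E.
  exists (fun n => G n - f) => //; split=> //.
  apply: (weakstar_close dd) => // N; exists N.*2 => // n /= Nn.
  have Nn2 : (N <= n./2)%N by rewrite -(doubleK N) half_leq.
  by apply: close_anti Nn2 _; rewrite /G; case: ifP => _; case: (H n./2).
rewrite EFinD; apply: leeD.
- rewrite lee_fin; apply: lb_le_inf; first by exists (tail_diam (fun n => G n - f) 0), 0%N.
  move=> _ [m _ <-]; have [_ _ _ _ [_ _ hc]] := H m.
  apply: le_trans hc _.
  have -> : g m - h m = (G m.*2 - f) - (G m.*2.+1 - f).
    rewrite /G /= odd_double /= uphalf_double doubleK.
    by rewrite opprB addrA subrK.
  by apply: dnorm_le_tail_diam fGB _ _; lia.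
- apply: le_limn_einf; apply: nearW => n; rewrite fG /G.
  by case: ifP => _; case: (H n./2) => _ _ _ _ [].
Qed.

Lemma lt_pi_step P f (t : R) : (t%:E < pi_step P f)%E ->
  exists c l, [/\ t < c + l, 0 <= c <= 2 & spread P f c l].
Proof.
move=> /ereal_sup_gt[_ [xs [w0 xB] <-]].
set L := limn_einf _ => tL.
have [l tl lL] : exists2 l : R, t - ca xs < l & (l%:E < L)%E.
  case: L tL => [r| |] //=.
  - rewrite -EFinD lte_fin => tr; exists ((t - ca xs + r) / 2); first lra.
    by rewrite lte_fin; lra.
  - by move=> _; exists (t - ca xs + 1); [lra|exact: ltry].
(* The midpoint of [t - l] and [ca xs]: strictly below the latter, so that every tail has a pair
   further apart, while [c0 + l] still exceeds [t]. *)
pose c0 := (ca xs + (t - l)) / 2; have c0ca : c0 < ca xs by rewrite /c0; lra.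
have sp N : exists g h,
    [/\ dual_ball g, dual_ball h, close d N f g, close d N f h &
      [/\ (l%:E <= P g)%E, (l%:E <= P h)%E & c0 < dnorm (g - h)]].
  have [m _ hm] := filterI (close_weakstar d f w0 N) (lt_limn_einf lL).
  have : c0 < tail_diam xs m by apply: lt_le_trans c0ca _; exact: ca_le_tail_diam xB.
  rewrite -subr_gt0 => /sup_adherent /(_ (tail_diam_has_sup m xB)).
  move=> [_ [[i j] /= [mi mj] <-]]; rewrite -/(tail_diam xs m) subKr => cij.
  exists (f + xs i), (f + xs j); have [ci li] := hm i mi; have [cj lj] := hm j mj.
  by split=> //; split; [exact: ltW|exact: ltW|rewrite -translate_sub].
(* Truncation at 0 keeps [c] in a bounded interval, where cluster values exist. *)
exists (Num.max c0 0), l; split.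
- by apply: (@lt_le_trans _ _ (c0 + l)); [rewrite /c0; lra|rewrite lerD2r le_max lexx].
- have [g [h [gB hB _ _ [_ _ ch]]]] := sp 0%N.
  rewrite le_max lexx orbT ge_max /=; apply/andP; split; last lra.
  by apply: le_trans (ltW ch) _; exact: dnormB_le2.
- move=> N; have [g [h [gB hB cg ch [lg lh cgh]]]] := sp N.
  exists g, h; split=> //; split=> //.
  by rewrite ge_max (ltW cgh) dnormB_ge0.
Qed.

(* Upper semicontinuity holds for arbitrary [P]: near-extremal sequences are diagonalised. *)
Lemma pi_step_usc P f (t : R) : dual_ball f ->
  (forall N, exists g, [/\ dual_ball g, close d N f g & (t%:E <= pi_step P g)%E]) ->
  (t%:E <= pi_step P f)%E.
Proof.
move=> fB /choice[g gP]; apply/lee_addgt0Pr => e e0.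
have sp N : exists cl : R * R, [/\ t - e / 4 < cl.1 + cl.2, 0 <= cl.1 <= 2
    & spread P (g N) cl.1 cl.2].
  have [_ _ tg] := gP N.
  have [|c [l H]] := @lt_pi_step P (g N) (t - e / 4); last by exists (c, l).
  by apply: lt_le_trans tg; rewrite lte_fin; lra.
have /choice[cl clP] := sp.
(* Only the first components are known to be bounded. Near a cluster value [c] the second ones are
   at least about [t - c], so nothing has to be extracted for them. *)
have [n|c hc] := @bounded_cluster R (fun n => (cl n).1) 2.
  by have [_ /andP[c0 c2] _] := clP n; rewrite ger0_norm.
have /(pi_step_ge fB) : spread P f (c - e / 4) (t - e / 4 - c - e / 4).
  move=> N; have [|n Nn cn] := hc (e / 4) N.*2.+1; first lra.
  have [tn _ /(_ n) [u [v [uB vB cu cv [lu lv cuv]]]]] := clP n.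
  have [_ cg _] := gP n.
  exists u, v; split=> //.
  + by apply: close_trans (close_anti Nn cg) (close_anti Nn cu).
  + by apply: close_trans (close_anti Nn cg) (close_anti Nn cv).
  + move: cn; rewrite ltr_norml => /andP[cn1 cn2].
    split; [apply: le_trans lu|apply: le_trans lv|]; rewrite ?lee_fin; lra.
by move=> h; rewrite -leeBlDr //; apply: le_trans h; rewrite -EFinB lee_fin; lra.
Qed.

Lemma pi_step_mono P Q f : (forall g, dual_ball g -> (P g <= Q g)%E) ->
  (pi_step P f <= pi_step Q f)%E.
Proof.
move=> PQ; apply: ge_ereal_sup => _ [xs [w0 xB] <-].
apply: le_ereal_sup_tmp; eexists; first by exists xs.
rewrite leeD2l //; apply: limn_einf_mono; apply: nearW => n; exact: PQ.
Qed.

End PiStep.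

(** * The local form of (ii) and (iii), and bounds for transfinite families *)

Section Potentials.
Variables (R : realType) (X : normedModType R) (d : nat -> X).
Hypothesis dd : forall x (e : R), 0 < e -> exists n, `|x - d n| < e.
Implicit Types (f g h : X -> R) (mu pi : (X -> R) -> R).

(* A Lipschitz weak-star Kadec-Klee property, in which [mu] plays the role of the norm. *)
Definition lkk mu := forall f e, dual_ball f -> 0 < e ->
  exists N, forall g, dual_ball g -> close d N f g ->
    mu f + dnorm (g - f) <= mu g + e.

Lemma lkkPn mu f e : ~ (exists N, forall g, dual_ball g -> close d N f g ->
    mu f + dnorm (g - f) <= mu g + e) ->
  exists g : nat -> X -> R, forall N,
    [/\ dual_ball (g N), close d N f (g N) & mu (g N) + e < mu f + dnorm (g N - f)].
Proof.
move=> H; have /choice[g gP] N : exists g,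
    [/\ dual_ball g, close d N f g & mu g + e < mu f + dnorm (g - f)].
  apply: contrapT => no; apply: H; exists N => g gB c.
  by rewrite leNgt; apply/negP => lt; apply: no; exists g.
by exists g.
Qed.

Lemma dnormB_cluster f (g : nat -> X -> R) : dual_ball f -> (forall n, dual_ball (g n)) ->
  exists l : R, forall (e : R) N, 0 < e -> exists2 n, (N <= n)%N & `|l - dnorm (g n - f)| < e.
Proof.
move=> fB gB; apply: (@bounded_cluster _ _ 2) => n.
by rewrite ger0_norm ?dnormB_ge0 // dnormB_le2.
Qed.

Definition liminf_growth mu := forall f (xs : nat -> X -> R),
  dual_ball f -> (forall n, dual_ball (f + xs n)) -> weakstar_null xs ->
  ((mu f)%:E + limn_einf (fun n => (dnorm (xs n))%:E)
     <= limn_einf (fun n => (mu (f + xs n))%:E))%E.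

(** Failure of [lkk] yields a sequence tending weak-star to [f]. Along a subsequence with distances
    to [f] near [L], the right side of the growth inequality falls short of the left by at least
    [e / 2]. *)
Lemma liminf_growth_lkk mu : liminf_growth mu -> lkk mu.
Proof.
move=> H f e fB e0; apply: contrapT => /lkkPn[g gP].
have gB n : dual_ball (g n) by case: (gP n).
have [L hL] := dnormB_cluster fB gB.
have e4 : 0 < e / 4 by lra.
have /choice[k kP] N : exists n, (N <= n)%N /\ `|L - dnorm (g n - f)| < e / 4.
  by have [n] := hL _ N e4; exists n.
have fk n : f + (g (k n) - f) = g (k n) by rewrite addrC subrK.
have w0 : weakstar_null (fun n => g (k n) - f).
  apply: (weakstar_close dd) => // N; exists N => // n /= Nn.
  by have [_ c _] := gP (k n); apply: close_anti c; exact: leq_trans Nn (kP n).1.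
have kB n : dual_ball (f + (g (k n) - f)) by rewrite fk.
have := H f _ fB kB w0.
have h1 : ((mu f + (L - e / 4))%:E <=
    (mu f)%:E + limn_einf (fun n => (dnorm (g (k n) - f)%R)%:E))%E.
  rewrite EFinD leeD2l //; apply: le_limn_einf; apply: nearW => n.
  by have [_] := kP n; rewrite lee_fin ltr_norml => /andP[h1 h2]; lra.
have h2 : (limn_einf (fun n => (mu (f + (g (k n) - f))%R)%:E) <= (mu f + L + e / 4 - e)%:E)%E.
  apply: limn_einf_le => n; rewrite fk lee_fin.
  have [_ _ h3] := gP (k n).
  by have [_] := kP n; rewrite ltr_norml => /andP[h4 h5]; lra.
by move=> /(le_trans h1) /le_trans /(_ h2); rewrite lee_fin; lra.
Qed.

Lemma lkk_liminf_growth mu : lkk mu -> liminf_growth mu.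
Proof.
move=> H f xs fB xB w0; apply/lee_addgt0Pr => e e0.
have [N hN] := H f e fB e0.
rewrite -limn_einf_shift // addeC -limn_einf_shift //.
apply: limn_einf_mono; have := close_weakstar d f w0 N; apply: filterS => n c.
by have := hN _ (xB n) c; rewrite addrAC subrr add0r -!EFinD lee_fin; lra.
Qed.

Definition pi_super pi := forall f, dual_ball f ->
  (pi_step (EFin \o pi) f <= (pi f)%:E)%E.

(** For a pair near [f], [|g - h| <= |g - f| + |h - f| <= mu g + mu h - 2 mu f + 2 e]; the two
    distances account for the factor 2. *)
Lemma lkk_pi_super mu : lkk mu -> pi_super (fun f => - 2 * mu f).
Proof.
move=> H f fB; rewrite leNgt; apply/negP => /(@lt_pi_step _ _ d)[c [l [cl _ sp]]].
pose e := (c + l - - 2 * mu f) / 4; have e0 : 0 < e by rewrite /e; lra.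
have [N hN] := H f e fB e0; have [g [h [gB hB cg ch [lg lh cgh]]]] := sp N.
have := hN g gB cg; have := hN h hB ch; have := dnormB_triangle gB hB fB.
by move: lg lh; rewrite !lee_fin /e; lra.
Qed.

(** Failure at [f] gives [g n] near [f], at distance about [L], with [pi (g n)] at least about
    [pi f - L + e]. By weak-star lower semicontinuity of the norm, [g n] and a much later [g m] are
    at least about [L] apart, so [pi_step] exceeds [pi f]. *)
Lemma pi_super_lkk pi : pi_super pi -> lkk (fun f => - pi f).
Proof.
move=> H f e fB e0; apply: contrapT => /lkkPn[g gP].
have gB n : dual_ball (g n) by case: (gP n).
have [L hL] := dnormB_cluster fB gB.
have e4 : 0 < e / 4 by lra.
suff sp : spread d (EFin \o pi) f (L - e / 2) (pi f - L + e * 3 / 4).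
  have := le_trans (pi_step_ge dd fB sp) (H f fB).
  by rewrite lee_fin; lra.
move=> N; have [n Nn] := hL _ N e4; rewrite ltr_norml => /andP[n1 n2].
have [x x1 hx] : exists2 x, `|x| <= 1 & L - e / 4 < `|(g n - f) x|.
  by apply: lt_dnorm; [exact: is_dualB (gB n).1 fB.1|lra].
have e8 : 0 < e / 8 by lra.
have [M hM] := close_pointwise dd x e8.
have [m Mm] := hL _ (maxn M N) e4; rewrite ltr_norml => /andP[m1 m2].
have [_ cn gn] := gP n; have [_ cm gm] := gP m.
exists (g n), (g m); split => //.
- exact: close_anti Nn cn.
- by apply: close_anti cm; apply: leq_trans Mm; exact: leq_maxr.
- split; rewrite ?lee_fin /=; [lra|lra|].
  have := dual_ballB_norm x (gB n) (gB m).
  have : `|f x - g m x| < e / 8.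
    by apply: hM => //; apply: close_anti cm; apply: leq_trans Mm; exact: leq_maxl.
  have : dnorm (g n - g m) * `|x| <= dnorm (g n - g m).
    by rewrite ler_piMr // dnormB_ge0.
  have := ler_distD (g m x) (g n x) (f x); rewrite (distrC (g m x)).
  move: hx; rewrite -[(g n - f) x]/(g n x - f x); lra.
Qed.

Lemma from_below_proper (W : Type) (lt : W -> W -> Prop) (w : W) :
  (forall a b c, lt a b -> lt b c -> lt a c) ->
  (forall a b, [\/ lt a b, a = b | lt b a]) ->
  (exists v, lt v w) -> (forall v, lt v w -> exists u, lt v u /\ lt u w) ->
  ProperFilter (from_below lt w).
Proof.
move=> tr tot ex lim; apply: filter_from_proper => //.
apply: filter_from_filter => // i j iw jw.
have [ij|<-|ji] := tot i j; [exists j|exists i|exists i] => //.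
- by move=> v [jv vw]; split=> //=; split=> //; exact: tr ij jv.
- by move=> v [iv vw]; split=> //=; split=> //; exact: tr ji iv.
Qed.

(** Transfinite induction: [pi + M] is non-negative, adding the constant [M] commutes with
    [pi_step], and the bound passes to limits. *)
Lemma pi_family_le pi (M : R) (W : Type) (lt : W -> W -> Prop)
    (P : W -> (X -> R) -> \bar R) :
  pi_super pi -> (forall f, dual_ball f -> `|pi f| <= M) ->
  well_founded lt -> (forall a b c, lt a b -> lt b c -> lt a c) ->
  (forall a b, [\/ lt a b, a = b | lt b a]) -> pi_family lt P ->
  forall w f, dual_ball f -> (P w f <= (pi f + M)%:E)%E.
Proof.
move=> H piM wf tr tot fam; elim/(well_founded_ind wf) => w IH f fB.
have [h0 hS hL] := fam w f fB.
have [[v0 v0w]|nov] := pselect (exists v, lt v w); last first.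
  rewrite h0 => [|v vw]; last by apply: nov; exists v.
  by rewrite lee_fin; have := piM f fB; rewrite ler_norml => /andP[]; lra.
have [[v [vw vS]]|lim] := pselect (exists v, lt v w /\ forall u, ~ (lt v u /\ lt u w)).
  rewrite (hS v vw vS); apply: ge_ereal_sup => _ [xs [xs0 xB] <-].
  apply: (@le_trans _ _ (M%:E + pi_step (EFin \o pi) f)%E); last first.
    by rewrite (addrC (pi f)) EFinD leeD2l //; exact: H.
  apply: (@le_trans _ _ (M%:E + ((ca xs)%:E + limn_einf (fun n => (pi (f + xs n)%R)%:E)))%E).
    rewrite addeCA leeD2l // -limn_einf_shift //.
    by apply: limn_einf_mono; apply: nearW => n; rewrite -EFinD (addrC M); exact: IH.
  by rewrite leeD2l //; apply: ereal_sup_ubound; exists xs.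
have lim' v : lt v w -> exists u, lt v u /\ lt u w.
  move=> vw; apply: contrapT => nou; apply: lim; exists v; split=> // u hu.
  by apply: nou; exists u.
have ex : exists v, lt v w by exists v0.
have PF := from_below_proper tr tot ex lim'.
apply: (@closed_cvg _ _ _ PF _ (fun y => (y <= (pi f + M)%:E)%E) _ _ _ (hL ex lim')).
  exact: closed_ereal_ge_ereal.
by exists v0 => // v [_ vw]; exact: IH.
Qed.

End Potentials.

(** * Countable well-orders, their tops and their sums *)

Record countable_wo := CountableWo {
  wo_sort :> countType;
  wo_lt : wo_sort -> wo_sort -> Prop;
  wo_wf : well_founded wo_lt;
  wo_trans : forall a b c, wo_lt a b -> wo_lt b c -> wo_lt a c;
  wo_total : forall a b, [\/ wo_lt a b, a = b | wo_lt b a] }.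

Definition wo_unit : countable_wo.
Proof.
refine (@CountableWo unit (fun _ _ => False) _ _ _) => //.
by move=> [] [] ; constructor 2.
Defined.

Section OrderSums.

Definition top_lt (T : Type) (lt : T -> T -> Prop) (x y : option T) : Prop :=
  match x, y with
  | Some a, Some b => lt a b
  | Some _, None => True
  | None, _ => False
  end.

Definition wo_top (W : countable_wo) : countable_wo.
Proof.
refine (@CountableWo (option W) (top_lt (@wo_lt W)) _ _ _).
- have aS (a : W) : Acc (top_lt (@wo_lt W)) (Some a).
    elim/(well_founded_ind (@wo_wf W)): a => a IH.
    apply: Acc_intro => -[b ba|[]]; exact: IH.
  by move=> [a|]; [exact: aS|apply: Acc_intro => -[b _|[]]; exact: aS].
- move=> [a|] [b|] [c|] ab bc; try by [|case: ab|case: bc].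
  exact: wo_trans ab bc.
- move=> [a|] [b|] /=; [|by constructor 1|by constructor 3|by constructor 2].
  by have [?|->|?] := wo_total a b; [constructor 1|constructor 2|constructor 3].
Defined.

Variable W : nat -> countable_wo.

(** Lexicographic order. The second alternative names the common index, so that no element is
    transported between fibres. *)
Definition sum_lt (u v : {n & W n}) : Prop :=
  (tag u < tag v)%N \/
  exists n (a b : W n), [/\ u = Tagged W a, v = Tagged W b & wo_lt a b].

Lemma Tagged_inj n : injective (@Tagged nat n W).
Proof. by move=> a b /eqP; rewrite eq_Tagged => /eqP. Qed.

Definition wo_sum : countable_wo.
Proof.
refine (@CountableWo {n & W n} sum_lt _ _ _).
- suff aT n (a : W n) : Acc sum_lt (Tagged W a) by move=> [n a]; exact: aT.
  elim/ltn_ind: n a => n IHn a; elim/(well_founded_ind (@wo_wf (W n))): a => a IHa.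
  apply: Acc_intro => -[m b] [/= mn|[k [b' [a' [Eb Ea lt]]]]]; first exact: IHn.
  have nk : n = k := congr1 tag Ea.
  by subst k; rewrite Eb; apply: IHa; rewrite (Tagged_inj Ea).
- move=> u v w [uv|[n [a [b [-> -> ab]]]]] [vw|[m [b' [c [Eb -> bc]]]]].
  + by left; exact: ltn_trans uv vw.
  + by left; rewrite Eb in uv.
  + by left.
  + have nm : n = m := congr1 tag Eb.
    subst m; right; exists n, a, c; split=> //.
    by apply: wo_trans ab _; rewrite (Tagged_inj Eb).
- move=> [n a] [m b]; have [nm|mn|nm] := ltngtP n m.
  + by constructor 1; left.
  + by constructor 3; left.
  + subst m; have [ab|->|ba] := wo_total a b.
    * by constructor 1; right; exists n, a, b.
    * by constructor 2.
    * by constructor 3; right; exists n, b, a.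
Defined.

End OrderSums.

(** * Transfinite iterates of [pi_step] *)

Section Iterates.
Variables (R : realType) (X : normedModType R).
Implicit Types (f g h : X -> R) (P : (X -> R) -> \bar R).

Lemma weakstar_null0 : @weakstar_null R X (fun _ => 0).
Proof. by move=> x; exact: cvg_cst. Qed.

Lemma dnorm0 : @dnorm R X 0 = 0.
Proof.
rewrite /dnorm -[RHS](@sup1 R); congr sup; apply/seteqP; split=> [_ [x _ <-]|_ ->] /=.
  by rewrite normr0.
by exists 0 => /=; rewrite normr0.
Qed.

Lemma ca0 : ca (fun _ => 0 : X -> R) = 0.
Proof.
have td m : @tail_diam R X (fun _ => 0) m = 0.
  rewrite /tail_diam -[RHS](@sup1 R); congr sup; apply/seteqP.
  split=> [_ [ij _ <-]|_ ->] /=; rewrite ?subrr ?dnorm0 //.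
  by exists (m, m) => //=; rewrite subrr dnorm0.
rewrite /ca -[RHS](@inf1 R); congr inf; apply/seteqP.
split=> [_ [m _ <-]|_ ->] /=; first exact: td.
by exists 0%N.
Qed.

Lemma le_pi_step P f : dual_ball f -> (P f <= pi_step P f)%E.
Proof.
move=> fB; apply: le_ereal_sup_tmp.
exists ((ca (fun _ => 0 : X -> R))%:E + limn_einf (fun _ => P (f + 0)%R))%E.
  by exists (fun _ => 0) => //; split=> [|n]; [exact: weakstar_null0|rewrite addr0].
rewrite ca0 add0e; apply: le_limn_einf; apply: nearW => n; by rewrite addr0.
Qed.

Section Recursion.
Variables (W : Type) (lt : W -> W -> Prop).
Hypothesis wf : well_founded lt.

(* A uniform recursion for zero, successors and limits: it agrees with the
   definition of [pi_family] because the iterates increase. *)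
Definition pi_iter : W -> (X -> R) -> \bar R :=
  Fix wf (fun _ => (X -> R) -> \bar R) (fun w rec f =>
    ereal_sup [set y | y = 0%E \/ exists v (vw : lt v w), y = pi_step (rec v vw) f]).

Lemma pi_iterE w f : pi_iter w f =
  ereal_sup [set y | y = 0%E \/ exists2 v, lt v w & y = pi_step (pi_iter v) f].
Proof.
rewrite /pi_iter Fix_eq => [|u p q pq].
  congr ereal_sup; apply/seteqP; split=> y [->|[v]]; try by left.
  - by move=> [vw ->]; right; exists v.
  - by move=> vw ->; right; exists v, vw.
apply/funext => g; congr ereal_sup; apply/seteqP.
by split=> y [->|[v [vu ->]]]; try (by left); right; exists v, vu; rewrite pq.
Qed.

Lemma pi_iter_ge0 w f : (0 <= pi_iter w f)%E.
Proof. by rewrite pi_iterE; apply: ereal_sup_ubound; left. Qed.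

Lemma pi_iter_step v w f : lt v w -> (pi_step (pi_iter v) f <= pi_iter w f)%E.
Proof. by move=> vw; rewrite (pi_iterE w); apply: ereal_sup_ubound; right; exists v. Qed.

Lemma pi_iter_le w f c : (0 <= c)%E ->
  (forall v, lt v w -> (pi_step (pi_iter v) f <= c)%E) -> (pi_iter w f <= c)%E.
Proof.
move=> c0 h; rewrite pi_iterE; apply: ge_ereal_sup => _ [->//|[v vw ->]]; exact: h.
Qed.

Hypothesis tr : forall a b c, lt a b -> lt b c -> lt a c.
Hypothesis tot : forall a b, [\/ lt a b, a = b | lt b a].

Lemma pi_iter_mono v w f : lt v w -> (pi_iter v f <= pi_iter w f)%E.
Proof.
move=> vw; apply: pi_iter_le => [|u uv]; first exact: pi_iter_ge0.
by apply: pi_iter_step; exact: tr uv vw.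
Qed.

(** At a successor the predecessor contributes the largest term, by monotonicity. At a limit every
    term is overtaken by a later iterate, so the supremum is the limit. *)
Lemma pi_iter_family : pi_family lt pi_iter.
Proof.
move=> w f fB; split=> [now|v vw vS|ex lim].
- apply/eqP; rewrite eq_le pi_iter_ge0 andbT; apply: pi_iter_le => // v vw.
  by case: (now v).
- apply/eqP; rewrite eq_le pi_iter_step // andbT; apply: pi_iter_le => [|u uw].
    by apply: le_trans (pi_iter_ge0 v f) _; exact: le_pi_step.
  have [uv|->//|vu] := tot u v; last by case: (vS u).
  by apply: pi_step_mono => g gB; exact: pi_iter_mono.
- have PF := from_below_proper tr tot ex lim.
  have lo (a : \bar R) : (a < pi_iter w f)%E ->
      \forall v \near from_below lt w, (a < pi_iter v f)%E.
    rewrite {1}pi_iterE => /ereal_sup_gt[y [->|[v vw ->]] ay].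
      have [v vw] := ex; exists v => // u _; exact: lt_le_trans ay (pi_iter_ge0 _ _).
    have [u [vu uw]] := lim v vw; exists u => // t [ut tw].
    apply: lt_le_trans ay _; apply: pi_iter_step; exact: tr vu ut.
  have hi : \forall v \near from_below lt w, (pi_iter v f <= pi_iter w f)%E.
    by have [v vw] := ex; exists v => // u [_ uw]; exact: pi_iter_mono.
  move: lo hi; move: (pi_iter_ge0 w f); move: (pi_iter w f) => [r| |] // r0 lo hi.
  + apply/fine_cvgP; split.
      apply: filterS hi => v hv; rewrite ge0_fin_numE ?pi_iter_ge0 //.
      by apply: le_lt_trans hv _; exact: ltry.
    apply/cvgrPdist_lt => e e0.
    have /lo lo' : ((r - e)%:E < r%:E)%E by rewrite lte_fin; lra.
    apply: filterS2 lo' hi => v; rewrite /=.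
    have := pi_iter_ge0 v f; case: (pi_iter v f) => [s| |] //= _.
    by rewrite lte_fin lee_fin ltr_norml => h1 h2; apply/andP; split; lra.
  + apply/cvgeyPgt => A; apply: lo; exact: ltry.
Qed.

End Recursion.

Lemma pi_iter_embed (W W' : Type) (lt : W -> W -> Prop) (lt' : W' -> W' -> Prop)
    (wf : well_founded lt) (wf' : well_founded lt') (e : W -> W') :
  (forall a b, lt a b -> lt' (e a) (e b)) ->
  forall w f, dual_ball f -> (pi_iter wf w f <= pi_iter wf' (e w) f)%E.
Proof.
move=> emono; elim/(well_founded_ind wf) => w IH f fB.
apply: pi_iter_le => [|v vw]; first exact: pi_iter_ge0.
apply: (@le_trans _ _ (pi_step (pi_iter wf' (e v)) f)).
  by apply: pi_step_mono => g gB; exact: IH.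
by apply: pi_iter_step; exact: emono.
Qed.

(** A point of a countable well-order stands for the ordinal of its predecessors; points of
    different orders are compared through [pi_iter_embed]. *)
Definition stage := {W : countable_wo & W}.

Definition stage_fun (s : stage) : (X -> R) -> \bar R :=
  pi_iter (@wo_wf (tag s)) (tagged s).

(** Countable ordinals are closed under countable suprema: the orders are placed end to end, and the
    adjoined top lies strictly above every [S n], which accounts for the extra [pi_step]. *)
Lemma stage_sup (S : nat -> stage) : exists s, forall n f, dual_ball f ->
  (pi_step (stage_fun (S n)) f <= stage_fun s f)%E.
Proof.
pose W n := tag (S n).
exists (existT _ (wo_top (wo_sum W)) None) => n f fB.
apply: (@le_trans _ _ (pi_step (pi_iter (@wo_wf (wo_top (wo_sum W)))
    (Some (Tagged W (tagged (S n))))) f)).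
  apply: pi_step_mono => g gB.
  apply: (@pi_iter_embed _ _ _ _ _ _ (fun a : W n => Some (Tagged W a))) => //.
  by move=> a b ab; right; exists n, a, b.
exact: pi_iter_step.
Qed.

End Iterates.

(** * Stabilisation of the iterates at a countable stage *)

Section Stabilization.
Variables (R : realType) (X : normedModType R) (d : nat -> X).
Hypothesis dd : forall x (e : R), 0 < e -> exists n, `|x - d n| < e.
Implicit Types (f g h : X -> R) (s : stage).

(** Position of [f] on a grid of mesh [1 / (N + 1)]. The codes form a countable type, so a sequence
    can run through all of them. *)
Definition cell N f : seq int := [seq Num.floor (f (d i) * N.+1%:R) | i <- iota 0 N.+1].

Lemma cell_close N f g : cell N f = cell N g -> close d N f g.
Proof.
move=> E i iN.
have /(congr1 (fun t : seq int => nth 0 t i)) := E.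
rewrite !(nth_map 0%N) ?size_iota ?ltnS // nth_iota ?ltnS // add0n => Ei.
have N0 : 0 < N.+1%:R :> R by [].
rewrite -(ltr_pM2r N0) mulVf ?gt_eqF // -{1}(gtr0_norm N0) -normrM mulrBl.
have := floor_itv (f (d i) * N.+1%:R).
have := floor_itv (g (d i) * N.+1%:R).
rewrite Ei intrD => /andP[g1 g2] /andP[f1 f2].
by rewrite ltr_norml; apply/andP; split; lra.
Qed.

(* For each rational level [q] and each cell choose one iterate whose [pi_step]
   reaches [q] there; by upper semicontinuity a common successor of these
   countably many iterates has the largest [pi_step]. *)
Lemma stage_maximal : exists s0, forall s f, dual_ball f ->
  (pi_step (stage_fun s) f <= pi_step (stage_fun s0 : (X -> R) -> _) f)%E.
Proof.
pose reach (z : rat * nat * seq int) s := exists f,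
  [/\ dual_ball f, cell z.1.2 f = z.2 & ((ratr z.1.1)%:E <= pi_step (stage_fun s) f)%E].
(* A stage reaching [z] if there is one; otherwise the one-point order is a default. *)
have /choice[sz szP] z : exists s, forall s', reach z s' -> reach z s.
  have [[s' r]|no] := pselect (exists s, reach z s); first by exists s'.
  by exists (existT _ wo_unit tt) => s' r; exfalso; apply: no; exists s'.
pose S n := sz (odflt (0, 0%N, [::]) (unpickle n)).
have [s0 s0P] := stage_sup X S.
exists s0 => s f fB; apply/lee_addgt0Pr => e e0; rewrite leNgt; apply/negP => lt0.
have : (pi_step (stage_fun s0) f < pi_step (stage_fun s) f)%E.
  by apply: le_lt_trans lt0; rewrite leeDl // lee_fin ltW.
have pos : (0 <= pi_step (stage_fun s0) f)%E.
  by apply: le_trans (le_pi_step _ fB); exact: pi_iter_ge0.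
move=> {lt0}; case E0 : (pi_step (stage_fun s0) f) pos => [a| |] // _; last first.
  by move=> h; have := lt_le_trans h (leey _); rewrite ltxx.
move=> as_.
have [b ab bs] : exists2 b, a < b & (b%:E <= pi_step (stage_fun s) f)%E.
  case: (pi_step (stage_fun s) f) as_ => [b| |] //; first by rewrite lte_fin; exists b.
  by move=> _; exists (a + 1); [lra|exact: leey].
have [q] := rat_in_itvoo ab; rewrite in_itv /= => /andP[aq qb].
suff : ((ratr q)%:E <= pi_step (stage_fun s0) f)%E by rewrite E0 lee_fin; move: aq; lra.
(* As [f] lies in its own cell, [sz z] reaches [q] at some [g] of that cell; semicontinuity carries
   the level from these [g] to [f]. *)
apply: (pi_step_usc dd) => // N.
pose z := (q, N, cell N f).
have [|g [gB gc gq]] := szP z s.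
  by exists f; split=> //; apply: le_trans bs; rewrite lee_fin ltW.
exists g; split=> //; first exact: cell_close.
apply: le_trans gq _; apply: pi_step_mono => h hB.
have -> : sz z = S (pickle z) by rewrite /S pickleK.
by apply: le_trans (s0P _ _ hB); exact: le_pi_step.
Qed.

(** Let [s0] be maximal and [s1] a stage above [Q = pi_step (stage_fun s0)]. Then [Q] is finite, and
    [pi_step Q <= pi_step (stage_fun s1) <= Q]. *)
Lemma pi_super_of_stages : (forall s f, dual_ball f -> (stage_fun s f < +oo)%E) ->
  exists pi : (X -> R) -> R, (exists M : R, forall f, dual_ball f -> `|pi f| <= M) /\
    pi_super pi.
Proof.
move=> fin; have [s0 s0P] := stage_maximal.
have [s1 s1P] := stage_sup X (fun _ => s0).
pose Q := pi_step (stage_fun s0 : (X -> R) -> _).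
have Qge0 f : dual_ball f -> (0 <= Q f)%E.
  by move=> fB; apply: le_trans (le_pi_step _ fB); exact: pi_iter_ge0.
have Qfin f : dual_ball f -> Q f = (fine (Q f))%:E.
  move=> fB; rewrite fineK // ge0_fin_numE ?Qge0 //.
  by apply: le_lt_trans (s1P 0%N f fB) _; exact: fin.
exists (fine \o Q); split; last first.
  move=> f fB; rewrite /= -(Qfin _ fB); apply: le_trans _ (s0P s1 f fB).
  apply: pi_step_mono => g gB; rewrite /= -(Qfin _ gB); exact: s1P 0%N g gB.
(* Semicontinuity gives each [f] a neighbourhood where [Q < Q f + 1]; finitely many of them cover
   the ball, and the sum of their bounds serves as a maximum. *)
have /choice[N NP] f : exists N, dual_ball f -> forall g, dual_ball g ->
    close d N f g -> fine (Q g) < fine (Q f) + 1.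
  apply: contrapT => no.
  have fB : dual_ball f by apply: contrapT => nfB; apply: no; exists 0%N.
  suff : ((fine (Q f) + 1)%:E <= Q f)%E by rewrite [leRHS](Qfin _ fB) lee_fin; lra.
  apply: (pi_step_usc dd) => // N; apply: contrapT => noN; apply: no; exists N => _ g gB c.
  rewrite ltNge; apply/negP => le; apply: noN; exists g; split=> //.
  by rewrite -/(Q g) (Qfin _ gB) lee_fin.
have [t [tB tP]] := dual_ball_cover d N.
exists (\sum_(f <- t) (fine (Q f) + 1)) => g gB.
have Qr f : dual_ball f -> 0 <= fine (Q f) by move=> fB; rewrite -lee_fin -Qfin ?Qge0.
have [f ft c] := tP g gB; rewrite /= ger0_norm ?Qr //.
apply: le_trans (ltW (NP f (tB f ft) g gB c)) _.
rewrite (big_rem f) //= lerDl big_seq; apply: sumr_ge0 => h /mem_rem ht.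
by have := Qr h (tB h ht); lra.
Qed.

End Stabilization.

(** * Subspaces of c_0: the quotient norm from l_1 as a potential *)

Section SubspacesOfC0.
Variables (R : realType) (X : normedModType R) (d : nat -> X).
Hypothesis dd : forall x (e : R), 0 < e -> exists n, `|x - d n| < e.
Variables (T : X -> nat -> R) (c C : R).
Hypotheses (Tl : forall (a : R) x y n, T (a *: x + y) n = a * T x n + T y n)
  (T0 : forall x, T x @ \oo --> 0) (c0 : 0 < c) (C0 : 0 < C)
  (Tc : forall x, c * `|x| <= sup (range (fun n => `|T x n|)))
  (TC : forall x n, `|T x n| <= C * `|x|).
Implicit Types (f g h : X -> R) (a : nat -> R).

(* [f = sum_i a_i T_i] with [sum_i |a_i| <= s], written with partial sums only. *)
Definition c0_rep f a (s : R) := forall x M e, (forall i, (M <= i)%N -> `|T x i| <= e) ->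
  `|f x - \sum_(i < M) a i * T x i| <= e * (s - \sum_(i < M) `|a i|).

(** Polynomials stand for finitely supported sequences, the monomials being the unit vectors. *)
Let shift_norm (xq : X * {poly R}) := sup (range (fun i => `|T xq.1 i + xq.2`_i|)).

Let shift_ub (xq : X * {poly R}) i : `|T xq.1 i + xq.2`_i| <= shift_norm xq.
Proof.
apply: ub_le_sup; last by exists i.
exists (C * `|xq.1| + \sum_(j < size xq.2) `|xq.2`_j|) => _ [j _ <-].
apply: le_trans (ler_normD _ _) (lerD (TC _ _) _).
have [js|sj] := ltnP j (size xq.2); last by rewrite nth_default // normr0 sumr_ge0.
by rewrite (bigD1 (Ordinal js)) //= lerDl sumr_ge0.
Qed.

Let shift_le (xq : X * {poly R}) e : (forall i, `|T xq.1 i + xq.2`_i| <= e) ->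
  shift_norm xq <= e.
Proof.
move=> h; apply: ge_sup; first by exists `|T xq.1 0%N + xq.2`_0|, 0%N.
by move=> _ [i _ <-].
Qed.

Lemma embedding0 n : T 0 n = 0.
Proof. by have := Tl 1 0 0 n; rewrite scaler0 addr0 mul1r; lra. Qed.

Let pairD t (x y : X) (p q : {poly R}) : (t *: x + y, t *: p + q) = t *: (x, p) + (y, q).
Proof. by []. Qed.

(** Hahn-Banach extends [f] from [X] to [X] plus the finitely supported sequences, dominated by
    [c^-1] times the sup norm; [a i] is the value at the i-th unit vector. *)
Lemma c0_rep_exists f : dual_ball f -> exists a, c0_rep f a c^-1.
Proof.
move=> /dual_ballP[fl f1].
have f0 : f 0 = 0 by have := fl 1 0 0; rewrite scaler0 addr0 mul1r; lra.
have [||||F [Fl Fp Ff]] := @hahn_banach R (X * {poly R})%type X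
    (fun xq => c^-1 * shift_norm xq) (fun x => (x, 0)) f.
- split=> [u v|t u t0].
    rewrite -mulrDr ler_pM2l ?invr_gt0 //; apply: shift_le => i /=.
    have -> : T (u.1 + v.1) i + (u.2 + v.2)`_i = (T u.1 i + u.2`_i) + (T v.1 i + v.2`_i).
      by have := Tl 1 u.1 v.1 i; rewrite scale1r mul1r coefD => ->; lra.
    exact: le_trans (ler_normD _ _) (lerD (shift_ub _ _) (shift_ub _ _)).
  rewrite mulrCA ler_pM2l ?invr_gt0 //; apply: shift_le => i /=.
  have -> : T (t *: u.1) i + (t *: u.2)`_i = t * (T u.1 i + u.2`_i).
    by have := Tl t u.1 0 i; rewrite embedding0 !addr0 coefZ => ->; lra.
  by rewrite normrM ger0_norm // ler_wpM2l.
- by move=> a x y; rewrite -pairD scaler0 addr0.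
- by move=> a x y; rewrite fl.
- move=> x; rewrite ler_pdivlMl //; apply: le_trans (_ : c * `|x| <= _).
    by rewrite ler_pM2l //; apply: le_trans (f1 x); exact: ler_norm.
  apply: le_trans (Tc x) _; apply: ge_sup; first by exists `|T x 0%N|, 0%N.
  by move=> _ [i _ <-]; have := shift_ub (x, 0) i; rewrite /= coef0 addr0.
pose a i := F (0, 'X^i); exists a => x M e hx.
have F0 : F 0 = 0 by have := Fl 1 0 0; rewrite scaler0 addr0 mul1r; lra.
have Fsum (E : nat -> R) n : F (0, \sum_(i < n) E i *: 'X^i) = \sum_(i < n) E i * a i.
  elim: n => [|n IH]; first by rewrite !big_ord0.
  rewrite !big_ord_recr /= -IH [RHS]addrC -Fl -pairD scaler0 addr0.
  by rewrite [in LHS]addrC.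
have e0 : 0 <= e by apply: le_trans (hx M (leqnn M)).
have half y : (forall i, (M <= i)%N -> `|T y i| <= e) ->
    f y - \sum_(i < M) a i * T y i <= e * (c^-1 - \sum_(i < M) `|a i|).
  (* The shift replaces the first [M] coordinates of [T y] by [e] times the sign of [a i], which
     leaves a sup norm of at most [e]. *)
  move=> hy; pose E i := - T y i + e * Num.sg (a i).
  have := Fp (y, \poly_(i < M) E i).
  have -> : F (y, \poly_(i < M) E i) = f y + \sum_(i < M) E i * a i.
    rewrite -Fsum -Ff -[F (y, 0)]mul1r -Fl -pairD !scale1r add0r addr0 poly_def.
    by [].
  have -> : \sum_(i < M) E i * a i = - \sum_(i < M) a i * T y i + e * \sum_(i < M) `|a i|.
    rewrite mulr_sumr -sumrN -big_split /=; apply: eq_bigr => i _.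
    by rewrite /E [`|a i|]normrEsg; lra.
  have : c^-1 * shift_norm (y, \poly_(i < M) E i) <= c^-1 * e.
    rewrite ler_pM2l ?invr_gt0 //; apply: shift_le => i /=.
    rewrite coef_poly; case: ltnP => [iM|Mi]; last by rewrite addr0 hy.
    rewrite /E addrA subrr add0r normrM ger0_norm // ler_piMr //.
    by rewrite normr_sg lern1; case: (a i != 0).
  by lra.
rewrite ler_norml half // andbT.
have TN i : T (- x) i = - T x i.
  by have := Tl (-1) x 0 i; rewrite embedding0 !addr0 scaleN1r mulN1r.
have fN : f (- x) = - f x.
  by have := fl (-1) x 0; rewrite f0 !addr0 scaleN1r mulN1r.
have := half (- x); rewrite fN.
have -> : \sum_(i < M) a i * T (- x) i = - \sum_(i < M) a i * T x i.
  by rewrite -sumrN; apply: eq_bigr => i _; rewrite TN mulrN.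
move=> /(_ _) h; have {h} := h _; rewrite -lerN2 opprD !opprK; apply.
by move=> i Mi; rewrite TN normrN hx.
Qed.

Lemma c0_rep_sum f a s M : c0_rep f a s -> \sum_(i < M) `|a i| <= s.
Proof.
move=> /(_ 0 M 1) h; rewrite -subr_ge0 -[leRHS]mul1r; apply: le_trans (h _) => //.
by move=> i _; rewrite embedding0 normr0.
Qed.

Lemma c0_rep_ge0 f a s : c0_rep f a s -> 0 <= s.
Proof. by move=> /(c0_rep_sum 0); rewrite big_ord0. Qed.

(** Since [T x] tends to 0, any [s] already gives [f x = sum_i a_i T_i x]; the remainder is then
    bounded by the actual l_1 mass beyond [M]. *)
Lemma c0_rep_total f a s : c0_rep f a s ->
  c0_rep f a (sup (range (fun M => \sum_(i < M) `|a i|))).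
Proof.
move=> r x M e hx; set sg := sup _.
have s0 : 0 <= s := c0_rep_ge0 r.
have sgM n : \sum_(i < n) `|a i| <= sg.
  by apply: ub_le_sup; [exists s => _ [m _ <-]; exact: c0_rep_sum r|exists n].
have e0 : 0 <= e by apply: le_trans (hx M (leqnn M)).
apply/ler_addgt0Pr => t t0.
have ts : 0 < t / (s + 1) by rewrite divr_gt0 // ltr_wpDl.
have /cvgr0Pnorm_lt /(_ _ ts)[k _ hk] := T0 x.
have tail n : `|\sum_(i < M + n) a i * T x i - \sum_(i < M) a i * T x i| <=
    e * (\sum_(i < M + n) `|a i| - \sum_(i < M) `|a i|).
  elim: n => [|n IH]; first by rewrite addn0 !subrr normr0 mulr0.
  rewrite addnS !big_ord_recr /=.
  have : `|a (M + n)%N * T x (M + n)%N| <= e * `|a (M + n)%N|.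
    by rewrite normrM mulrC ler_wpM2r // hx // leq_addr.
  move: IH; set A := \sum_(i < M + n) _; set B := \sum_(i < M + n) _.
  move=> IH h; rewrite (addrAC A) (addrAC B) mulrDr.
  exact: le_trans (ler_normD _ _) (lerD IH h).
have big : `|f x - \sum_(i < M + k) a i * T x i| <= t.
  have {}hk i : (M + k <= i)%N -> `|T x i| <= t / (s + 1).
    by move=> Mi; apply: ltW; apply: hk => /=; apply: leq_trans Mi; exact: leq_addl.
  apply: le_trans (r x _ _ hk) _; rewrite mulrAC ler_pdivrMr ?ltr_wpDl //.
  by rewrite ler_pM2l //; have : 0 <= \sum_(i < M + k) `|a i| by [exact: sumr_ge0]; lra.
have := ler_distD (\sum_(i < M + k) a i * T x i) (f x) (\sum_(i < M) a i * T x i).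
have := tail k; have : e * (\sum_(i < M + k) `|a i| - \sum_(i < M) `|a i|) <=
  e * (sg - \sum_(i < M) `|a i|) by rewrite ler_wpM2l // lerD2r sgM.
by lra.
Qed.

(** The quotient norm under the map from l_1 sending [a] to [sum_i a_i T_i]. *)
Definition c0_norm f := inf [set s | exists a, c0_rep f a s].

Lemma c0_norm_le f a s : c0_rep f a s -> c0_norm f <= s.
Proof.
move=> r; apply: ge_inf; last by exists a.
by exists 0 => t [b /c0_rep_ge0].
Qed.

Lemma c0_norm_ge0 f : dual_ball f -> 0 <= c0_norm f.
Proof.
move=> fB; have [a r] := c0_rep_exists fB.
apply: lb_le_inf; first by exists c^-1, a.
by move=> t [b /c0_rep_ge0].
Qed.

(** Near-optimal representations [b n] of counterexamples [g n] converge coordinatewise along an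
    ultrafilter to a representation [a] of [f]. Almost all mass of [a] sits on finitely many
    coordinates, where [b n] is close to [a]; so [|g n - f|] is at most about [C] times the excess
    of [s n] over the mass of [a]. *)
Lemma c0_norm_lkk : lkk d (fun f => C * c0_norm f).
Proof.
move=> f e fB e0; apply: contrapT => /lkkPn[g gP].
have gB n : dual_ball (g n) by case: (gP n).
have e1 : 0 < e / (2 * C) by rewrite divr_gt0 // mulr_gt0.
have /choice[sa saP] n : exists sa : R * (nat -> R),
    c0_rep (g n) sa.2 sa.1 /\ sa.1 < c0_norm (g n) + e / (2 * C).
  have hi : has_inf [set s | exists a, c0_rep (g n) a s].
    have [a r] := c0_rep_exists (gB n).
    split; first by exists c^-1, a.
    by exists 0 => t [b /c0_rep_ge0].
  by have [s [a r] h] := inf_adherent e1 hi; exists (s, a).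
pose s n := (sa n).1; pose b n := (sa n).2.
have rb n : c0_rep (g n) (b n) (s n) := (saP n).1.
pose K := c^-1 + e / (2 * C).
have sK n : 0 <= s n <= K.
  rewrite (c0_rep_ge0 (rb n)) /=.
  apply: le_trans (ltW (saP n).2) _; rewrite lerD2r.
  by have [a r] := c0_rep_exists (gB n); exact: c0_norm_le r.
have bK n i : `|b n i| <= K.
  apply: le_trans (le_trans (c0_rep_sum i.+1 (rb n)) _); last by case/andP: (sK n).
  by rewrite big_ord_recr /= lerDr sumr_ge0.
have [U [UU hU]] := free_ultrafilter.
have PU : ProperFilter U := @ultra_proper _ U UU.
have [l sl] : exists l : R, s @ U --> l.
  apply: (@ultra_bounded_cvg _ _ _ _ K) => //; apply: nearW => n.
  by have /andP[s0 ?] := sK n; rewrite ger0_norm.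
have /choice[a ba] i : exists l : R, b n i @[n --> U] --> l.
  by apply: (@ultra_bounded_cvg _ _ _ _ K) => //; apply: nearW.
have gf x : g n x @[n --> U] --> f x.
  apply/cvgrPdist_lt => t t0; have [N hN] := close_pointwise dd x t0.
  apply: filterS (hU N) => n Nn; apply: hN => //.
  by have [_ cn _] := gP n; exact: close_anti Nn cn.
have sum_cvg (u : nat -> nat -> R) (v : nat -> R) M :
    (forall i, u n i @[n --> U] --> v i) ->
    \sum_(i < M) u n i @[n --> U] --> \sum_(i < M) v i.
  move=> uv; elim: M => [|M IH].
    rewrite big_ord0; under eq_fun do rewrite big_ord0; exact: cvg_cst.
  rewrite big_ord_recr; under eq_fun do rewrite big_ord_recr.
  by apply: cvgD; [exact: IH|exact: uv].
have rf : c0_rep f a l.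
  move=> x M t hx.
  apply: (@ler_cvg_to _ U _ _ (fun n => `|g n x - \sum_(i < M) b n i * T x i|)
    (fun n => t * (s n - \sum_(i < M) `|b n i|))).
  - apply: cvg_norm; apply: cvgB; first exact: gf.
    apply: (sum_cvg (fun n i => b n i * T x i) (fun i => a i * T x i)) => i.
    by apply: cvgMl; exact: ba.
  - apply: cvgMr; apply: cvgB; first exact: sl.
    by apply: (sum_cvg (fun n i => `|b n i|) (fun i => `|a i|)) => i; apply: cvg_norm; exact: ba.
  - by apply: nearW => n; exact: rb.
(* The mass [sg] of [a] may be smaller than the limit [l] of the [s n]; the mass lost in the limit
   pays for the distance. *)
set sg := sup (range (fun M => \sum_(i < M) `|a i|)).
have rsg : c0_rep f a sg := c0_rep_total rf.
(* The estimate of [dn] loses [4 * C * t = e / 4] and near-optimality costs [e / 2], together less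
   than [e]. *)
pose t := e / (16 * C); have t0 : 0 < t by rewrite divr_gt0 // mulr_gt0.
have hs : has_sup (range (fun M => \sum_(i < M) `|a i|)).
  split; first by exists (\sum_(i < 0) `|a i|), 0%N.
  by exists l => _ [m _ <-]; exact: c0_rep_sum rf.
have [_ [M _ <-] Mt] := sup_adherent t0 hs; rewrite -/sg in Mt.
have : \sum_(i < M) `|a i - b n i| @[n --> U] --> \sum_(i < M) (0 : R).
  apply: (sum_cvg (fun n i => `|a i - b n i|) (fun _ => 0)) => i.
  rewrite -[X in _ --> X](normr0 R) -(subrr (a i)); apply: cvg_norm.
  by apply: cvgB; [exact: cvg_cst|exact: ba].
rewrite big1 // => /cvgr0Pnorm_lt /(_ t t0) hab.
have [n {hab}] := filter_ex hab; rewrite ger0_norm ?sumr_ge0 // => hn.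
have [_ _ gn] := gP n; have [_ sn] := saP n; rewrite -/(s n) in sn.
have dn : dnorm (g n - f) <= C * (s n - sg + 4 * t).
  apply: dnorm_le => x x1.
  have Tx i : (M <= i)%N -> `|T x i| <= C.
    by move=> _; apply: le_trans (TC x i) _; rewrite ler_piMr // ltW.
  have h1 := rb n x M C Tx; have h2 := rsg x M C Tx.
  have h3 : `|\sum_(i < M) b n i * T x i - \sum_(i < M) a i * T x i| <=
      C * \sum_(i < M) `|a i - b n i|.
    rewrite -sumrB mulr_sumr; apply: le_trans (ler_norm_sum _ _ _) _.
    apply: ler_sum => i _; rewrite -mulrBl normrM distrC mulrC ler_wpM2r //.
    by apply: le_trans (TC x i) _; rewrite ler_piMr // ltW.
  have h4 : \sum_(i < M) `|a i| <= \sum_(i < M) `|b n i| + \sum_(i < M) `|a i - b n i|.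
    rewrite -big_split /=; apply: ler_sum => i _.
    by have := ler_normD (b n i) (a i - b n i); rewrite (addrC (b n i)) subrK.
  have h5 := ler_distD (\sum_(i < M) b n i * T x i) (g n x) (f x).
  have h6 := ler_distD (\sum_(i < M) a i * T x i) (\sum_(i < M) b n i * T x i) (f x).
  rewrite (distrC (\sum_(i < M) a i * T x i) (f x)) in h6.
  apply: le_trans h5 _; apply: le_trans (lerD h1 (le_trans h6 (lerD h3 h2))) _.
  rewrite -!mulrDr ler_pM2l //; lra.
have Ct : C * t = e / 16 by rewrite /t; field; rewrite gt_eqF.
have Cs : C * s n < C * c0_norm (g n) + e / 2.
  have -> : e / 2 = C * (e / (2 * C)) by field; rewrite gt_eqF.
  by rewrite -mulrDr ltr_pM2l.
have := c0_norm_le rsg; rewrite -(ler_pM2l C0) => Cf.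
move: dn gn; rewrite mulrDr mulrBr (mulrCA C 4) Ct; lra.
Qed.

Lemma c0_norm_bounded f : dual_ball f -> `|C * c0_norm f| <= C / c.
Proof.
move=> fB; rewrite ger0_norm ?mulr_ge0 ?c0_norm_ge0 ?(ltW C0) // ler_pM2l //.
by have [a r] := c0_rep_exists fB; exact: c0_norm_le r.
Qed.

End SubspacesOfC0.

(** * An embedding into c_0 built from finite nets of the dual ball *)

Section EmbeddingIntoC0.
Variables (R : realType) (X : normedModType R) (d : nat -> X).
Hypothesis dd : forall x (e : R), 0 < e -> exists n, `|x - d n| < e.
Variables (mu : (X -> R) -> R) (M : R).
Hypotheses (muM : forall f, dual_ball f -> `|mu f| <= M) (mu_lkk : lkk d mu).
Implicit Types (f g h : X -> R).

Lemma dual_ball0 : dual_ball (0 : X -> R).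
Proof.
apply/dual_ballP; split=> [a x y|x]; last by rewrite normr0.
by rewrite -[LHS]/(0 : R) -[RHS]/(a * 0 + 0 : R) mulr0 addr0.
Qed.

(** The bound [4 ^ k] makes differences of close points less than [4 ^- k] at the early points of
    [d]; division by at least [2 ^- k] still leaves [2 ^- k]. *)
Lemma lkk_radius : exists N : nat -> (X -> R) -> nat, forall k f, dual_ball f ->
  (4 ^ k <= N k f)%N /\ forall g, dual_ball g -> close d (N k f) f g ->
    dnorm (g - f) <= mu g - mu f + 2 ^- k.
Proof.
suff /choice[N NP] (kf : nat * (X -> R)) : exists N, dual_ball kf.2 ->
    (4 ^ kf.1 <= N)%N /\ forall g, dual_ball g -> close d N kf.2 g ->
    dnorm (g - kf.2) <= mu g - mu kf.2 + 2 ^- kf.1.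
  by exists (fun k f => N (k, f)) => k f; exact: (NP (k, f)).
case: kf => k f /=; have [fB|nfB] := pselect (dual_ball f); last by exists 0%N.
have k0 : 0 < 2 ^- k :> R by rewrite invr_gt0 exprn_gt0.
have [N hN] := mu_lkk fB k0; exists (maxn (4 ^ k) N) => _; split; first exact: leq_maxl.
by move=> g gB /(close_anti (leq_maxr _ _)) c; have := hN g gB c; lra.
Qed.

(** In the recursion [r k.+1] is the largest radius used on [S k], so the point of [S k.+1] chosen
    for [g] is near [g] also at the scale of the preceding point. The radii in [rho] are doubled for
    [close_trans] through [g]. *)
Lemma lkk_nets : exists (N : nat -> (X -> R) -> nat) (S : nat -> seq (X -> R)),
  [/\ forall k f, dual_ball f -> (4 ^ k <= N k f)%N,
      forall k f, f \in S k -> dual_ball f,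
      forall k f g, dual_ball f -> dual_ball g -> close d (N k f) f g ->
        dnorm (g - f) <= mu g - mu f + 2 ^- k &
      forall g, dual_ball g -> exists f : nat -> X -> R,
        [/\ forall k, f k \in S k, forall k, close d (N k (f k)) (f k) g &
            forall k, close d (N k (f k)) (f k) (f k.+1)]].
Proof.
have [N NP] := lkk_radius.
pose rho (kr : nat * nat) f := (maxn (N kr.1 f) kr.2).*2.+1.
have /choice[net netP] kr := dual_ball_cover d (rho kr).
pose r := fix r k := if k is k'.+1 then \max_(f <- net (k', r k')) N k' f else 0%N.
pose S k := net (k, r k).
have SB k f : f \in S k -> dual_ball f by exact: (netP _).1.
exists N, S; split.
- by move=> k f fB; have [] := NP k f fB.
- exact: SB.
- by move=> k f g fB gB; have [_ h] := NP k f fB; exact: h.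
move=> g gB.
have /choice[f fP] k : exists f, f \in S k /\ close d (rho (k, r k) f) f g.
  by have [f] := (netP (k, r k)).2 g gB; exists f.
exists f; split=> [k|k|k]; first exact: (fP k).1.
  by apply: close_anti (fP k).2; rewrite /rho /=; lia.
have c1 : close d (N k (f k)).*2.+1 (f k) g.
  by apply: close_anti (fP k).2; rewrite /rho /=; lia.
have c2 : close d (N k (f k)).*2.+1 (f k.+1) g.
  apply: close_anti (fP k.+1).2; rewrite /rho ltnS leq_double.
  apply: leq_trans (leq_maxr _ _).
  by rewrite /= (big_rem (f k)) ?leq_maxl //; exact: (fP k).1.
exact: close_trans c1 (close_sym c2).
Qed.

Variables (N : nat -> (X -> R) -> nat) (S : nat -> seq (X -> R)).
Hypotheses (N4 : forall k f, dual_ball f -> (4 ^ k <= N k f)%N)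
  (SB : forall k f, f \in S k -> dual_ball f)
  (Nmu : forall k f g, dual_ball f -> dual_ball g -> close d (N k f) f g ->
     dnorm (g - f) <= mu g - mu f + 2 ^- k)
  (Spath : forall g, dual_ball g -> exists f : nat -> X -> R,
     [/\ forall k, f k \in S k, forall k, close d (N k (f k)) (f k) g &
         forall k, close d (N k (f k)) (f k) (f k.+1)]).

(* The maximum with [2 ^- k] is what makes the normalised steps weak-star null. *)
Definition step k f g : X -> R := (Num.max (dnorm (g - f)) (2 ^- k))^-1 *: (g - f).

(** Every triple is an index, with value 0 outside the finite lists, so that one numbering of
    triples covers all levels. Level 0 supplies the starting points of the paths. *)
Definition net_functional (z : nat * nat * nat) : X -> R :=
  let: (k, i, j) := z in
  if k is k'.+1 then
    if [&& (i < size (S k'))%N, (j < size (S k))%N &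
           `[< close d (4 ^ k') (nth 0 (S k') i) (nth 0 (S k) j) >]]
    then step k' (nth 0 (S k') i) (nth 0 (S k) j) else 0
  else if (i == 0%N) && (j < size (S 0))%N then nth 0 (S 0) j else 0.

Let max_gt0 k f g : 0 < Num.max (dnorm (g - f)) (2 ^- k) :> R.
Proof. by rewrite lt_max invr_gt0 exprn_gt0 // orbT. Qed.

Lemma step_dual_ball k f g : dual_ball f -> dual_ball g -> dual_ball (step k f g).
Proof.
move=> fB gB; apply/dual_ballP.
have E x : step k f g x = (Num.max (dnorm (g - f)) (2 ^- k))^-1 * (g x - f x) by [].
split=> [a x y|x]; first by rewrite !E fB.1.1 gB.1.1; lra.
rewrite E normrM gtr0_norm ?invr_gt0 // ler_pdivrMl //.
apply: le_trans (dual_ballB_norm x gB fB) _.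
by rewrite ler_wpM2r // le_max lexx.
Qed.

Lemma net_functional_dual_ball z : dual_ball (net_functional z).
Proof.
case: z => [[[|k] i] j] /=.
  by case: ifP => [/andP[_ h]|_]; [exact/SB/mem_nth|exact: dual_ball0].
case: ifP => [/and3P[hi hj _]|_]; last exact: dual_ball0.
by apply: step_dual_ball; apply/SB/mem_nth.
Qed.

Lemma net_functional_null x (e : R) : 0 < e -> exists K, forall k i j, (K <= k)%N ->
  `|net_functional (k.+1, i, j) x| < e.
Proof.
move=> e0; have e2 : 0 < e / 2 by lra.
have [m xm] := dd x e2.
have [n _ hn] := near_infty_natSinv_expn_lt (PosNum e2).
exists (maxn m n) => k i j; rewrite geq_max => /andP[mk nk].
have {}hn : 2 ^- k < e / 2 by have := hn k nk; rewrite /= div1r.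
have tB := net_functional_dual_ball (k.+1, i, j).
have td : `|net_functional (k.+1, i, j) (d m)| <= 2 ^- k.
  rewrite /=; case: ifP => [/and3P[hi hj /asboolP c]|_]; last first.
    by rewrite -[X in `|X|]/(0 : R) normr0 invr_ge0 exprn_ge0.
  set f := nth _ _ i; set g := nth _ _ j.
  have m4 : (m <= 4 ^ k)%N by apply: leq_trans mk (ltnW (ltn_expl k _)).
  have := c m m4; rewrite -/f -/g => fg.
  have -> : step k f g (d m) =
    (Num.max (dnorm (g - f)) (2 ^- k))^-1 * (g (d m) - f (d m)) by [].
  rewrite normrM gtr0_norm ?invr_gt0 // ler_pdivrMl // distrC.
  apply: le_trans (ltW fg) _; apply: (@le_trans _ _ (2 ^- k * 2 ^- k)); last first.
    by rewrite ler_wpM2r ?invr_ge0 ?exprn_ge0 // le_max lexx orbT.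
  rewrite -invfM -exprMn -natrM lef_pV2 ?posrE ?exprn_gt0 //.
  by rewrite -natrX ler_nat.
have tE : net_functional (k.+1, i, j) x = net_functional (k.+1, i, j) (d m)
    + net_functional (k.+1, i, j) (x - d m).
  by rewrite (is_dual_sub _ _ tB.1); lra.
have := (dual_ballP _).1 tB; rewrite tE => -[_ /(_ (x - d m)) t1].
have := ler_normD (net_functional (k.+1, i, j) (d m)) (net_functional (k.+1, i, j) (x - d m)).
lra.
Qed.

Definition net_embedding (x : X) (n : nat) : R :=
  if pickle_inv n is Some z then net_functional z x else 0.

Lemma net_embedding_le x n : `|net_embedding x n| <= `|x|.
Proof.
rewrite /net_embedding; case: pickle_inv => [z|]; last by rewrite normr0.
by have [_] := (dual_ballP _).1 (net_functional_dual_ball z).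
Qed.

Lemma net_embedding_linear (a : R) x y :
  net_embedding (a *: x + y) = a *: net_embedding x + net_embedding y.
Proof.
apply/funext => n; rewrite -[RHS]/(a * net_embedding x n + net_embedding y n).
rewrite /net_embedding; case: pickle_inv => [z|]; last by rewrite mulr0 addr0.
by rewrite (net_functional_dual_ball z).1.1.
Qed.

(** Levels up to [K] carry finitely many functionals other than 0; beyond all their codes only zeros
    and levels past [K] remain. *)
Lemma net_embedding_c0 x : net_embedding x @ \oo --> 0.
Proof.
apply/cvgr0Pnorm_lt => e e0; have [K hK] := net_functional_null x e0.
pose B := \max_(k < K.+1) size (S k).
have SizeB k : (k <= K)%N -> (size (S k) <= B)%N.
  by rewrite -ltnS => kK; rewrite /B (bigD1 (Ordinal kK)) //= leq_maxl.
pose F (p : 'I_K.+1 * 'I_B.+1 * 'I_B.+1) :=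
  pickle (nat_of_ord p.1.1, nat_of_ord p.1.2, nat_of_ord p.2).
exists (\max_p F p).+1 => // n /= Fn; rewrite /net_embedding.
have := @pickle_invK (nat * nat * nat)%type n.
case: pickle_inv => [[[k i] j]|] /=; last by rewrite normr0.
move=> En; have inB : (k <= K)%N -> (i <= B)%N -> (j <= B)%N -> False.
  rewrite -ltnS => hk; rewrite -ltnS => hi; rewrite -ltnS => hj.
  suff le_n : (n <= \max_p F p)%N by have := leq_trans Fn le_n; rewrite ltnn.
  by rewrite -En (bigD1 (Ordinal hk, Ordinal hi, Ordinal hj)) //= leq_maxl.
have z0 : `|(0 : X -> R) x| < e by rewrite -[X in `|X|]/(0 : R) normr0.
case: k En inB => [|k] En inB.
  case: ifP => [/andP[/eqP i0 hj]|//]; exfalso; apply: inB => //; first by rewrite i0.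
  by apply: leq_trans (ltnW hj) (SizeB _ _).
have [kK|Kk] := ltnP k K; last exact: hK k i j Kk.
case: ifP => [/and3P[hi hj _]|//]; exfalso; apply: inB => //.
  by apply: leq_trans (ltnW hi) (SizeB _ (ltnW kK)).
by apply: leq_trans (ltnW hj) (SizeB _ kK).
Qed.

Lemma net_embedding_sup x z : `|net_functional z x| <= sup (range (fun n => `|net_embedding x n|)).
Proof.
apply: ub_le_sup; first by exists `|x| => _ [n _ <-]; exact: net_embedding_le.
by exists (pickle z) => //; rewrite /net_embedding pickleK_inv.
Qed.

(** Telescoping along a path in the nets towards a norming functional of [x]: each increment is at
    most its normalising factor times [s], and these factors sum to a variation of [mu] plus a
    geometric series. *)
Lemma net_embedding_ge x : `|x| <= (5 + 2 * M) * sup (range (fun n => `|net_embedding x n|)).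
Proof.
set s := sup _; have [g gB gx] := norming_functional x.
have [f [fS fg ff]] := Spath gB.
have fB k : dual_ball (f k) := SB (fS k).
have s0 : 0 <= s.
  by apply: le_trans (net_embedding_sup x (0, 0, 0)%N).
have f0s : `|f 0%N x| <= s.
  have := net_embedding_sup x (0, 0, index (f 0%N) (S 0))%N.
  by rewrite /= index_mem fS nth_index.
(* Both entries of the maximum in [step] are dominated: [mu (f k.+1) - mu (f k) + 2 ^- k] bounds the
   norm, hence is non-negative. *)
have stepE k : `|f k.+1 x - f k x| <= (mu (f k.+1) - mu (f k) + 2 * 2 ^- k) * s.
  have c4 : close d (4 ^ k) (f k) (f k.+1) by apply: close_anti (ff k); exact: N4.
  have := net_embedding_sup x (k.+1, index (f k) (S k), index (f k.+1) (S k.+1))%N.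
  rewrite /= !index_mem !fS !nth_index // asboolT //= -/s.
  have -> : step k (f k) (f k.+1) x =
    (Num.max (dnorm (f k.+1 - f k)) (2 ^- k))^-1 * (f k.+1 x - f k x) by [].
  rewrite normrM gtr0_norm ?invr_gt0 // ler_pdivrMl // => h.
  apply: le_trans h _; apply: ler_wpM2r => //.
  have k0 : 0 <= 2 ^- k :> R by rewrite invr_ge0 exprn_ge0.
  have := Nmu (fB k) (fB k.+1) (ff k); have := dnormB_ge0 (fB k.+1) (fB k).
  by rewrite ge_max => h1 h2; apply/andP; split; lra.
(* Here 5 is 1 for the starting point plus 4 for the sum of all [2 * 2 ^- k]; the term
   [- 4 * 2 ^- n] lets the induction close. *)
have bound n : `|f n x| <= (5 + (mu (f n) - mu (f 0%N)) - 4 * 2 ^- n) * s.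
  elim: n => [|n IH]; first by rewrite expr0 invr1 subrr addr0; lra.
  have -> : 2 ^- n.+1 = 2 ^- n / 2 :> R by rewrite exprS invfM mulrC.
  have := ler_normD (f n.+1 x - f n x) (f n x); rewrite subrK.
  by have := stepE n; lra.
have Mb n : `|f n x| <= (5 + 2 * M) * s.
  apply: le_trans (bound n) _; apply: ler_wpM2r => //.
  have n0 : 0 <= 2 ^- n :> R by rewrite invr_ge0 exprn_ge0.
  have := muM (fB n); have := muM (fB 0%N).
  by rewrite !ler_norml => /andP[h1 h2] /andP[h3 h4]; lra.
apply/ler_addgt0Pr => e e0; have [K hK] := close_pointwise dd x e0.
have : `|f K x - g x| < e.
  apply: hK => //; apply: close_anti (fg K).
  by apply: leq_trans (N4 K (fB K)); apply: ltnW; exact: ltn_expl.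
have := ler_distD (f K x) (g x) 0; rewrite !subr0 gx (distrC `|x|) normr_id.
by have := Mb K; lra.
Qed.

End EmbeddingIntoC0.

(** * Equivalence of the four conditions *)

Lemma cvg0_has_ubound (R : realType) (u : nat -> R) : u @ \oo --> 0 ->
  has_ubound (range (fun n => `|u n|)).
Proof.
move=> /cvgr0Pnorm_lt /(_ 1 ltr01)[N _ hN].
exists (1 + \sum_(i < N) `|u i|) => _ [n _ <-].
have [Nn|nN] := leqP N n.
  by apply: le_trans (ltW (hN n Nn)) _; rewrite lerDl sumr_ge0.
by rewrite (bigD1 (Ordinal nN)) //= addrCA lerDl addr_ge0 // sumr_ge0.
Qed.

Lemma pi_superP (R : realType) (X : normedModType R) (pi : (X -> R) -> R) :
  pi_super pi <-> forall (f : X -> R) (xs : nat -> X -> R),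
    dual_ball f -> (forall n, dual_ball (f + xs n)) -> weakstar_null xs ->
    ((ca xs)%:E + limn_einf (fun n => (pi (f + xs n))%:E) <= (pi f)%:E)%E.
Proof.
split=> [H f xs fB xB w0|H f fB].
  by apply: le_trans (H f fB); apply: ereal_sup_ubound; exists xs.
by apply: ge_ereal_sup => _ [xs [w0 xB] <-]; exact: H.
Qed.

Theorem theorem7p2 (R : realType) (X : completeNormedModType R)
  (sepX : separable X) :
  let condi :=
    (* (i) X embeds isomorphically into c_0 *)
    exists T : X -> (nat -> R),
      (forall (a : R) (x y : X), T (a *: x + y) = a *: T x + T y) /\
      (forall x, T x @ \oo --> 0) /\
      exists c C : R, 0 < c /\ 0 < C /\
        forall x : X, c * `|x| <= sup (range (fun n => `|T x n|)) /\
                      sup (range (fun n => `|T x n|)) <= C * `|x| in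
  let condii :=
    (* (ii) *)
    exists mu : (X -> R) -> R,
      (exists M : R, forall f, dual_ball f -> `|mu f| <= M) /\
      forall (f : X -> R) (xs : nat -> X -> R),
        dual_ball f -> (forall n, dual_ball (f + xs n)) -> weakstar_null xs ->
        ((mu f)%:E + limn_einf (fun n => (dnorm (xs n))%:E)
           <= limn_einf (fun n => (mu (f + xs n))%:E))%E in
  let condiii :=
    (* (iii) *)
    exists pi : (X -> R) -> R,
      (exists M : R, forall f, dual_ball f -> `|pi f| <= M) /\
      forall (f : X -> R) (xs : nat -> X -> R),
        dual_ball f -> (forall n, dual_ball (f + xs n)) -> weakstar_null xs ->
        ((ca xs)%:E + limn_einf (fun n => (pi (f + xs n))%:E) <= (pi f)%:E)%E in
  let condiv :=
    (* (iv) pi^alpha_X < oo on B_{X^*} for every countable ordinal alpha: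
       alpha ranges over the elements w of countable well-orders (W, lt). *)
    forall (W : countType) (lt : W -> W -> Prop),
      well_founded lt ->
      (forall a b c, lt a b -> lt b c -> lt a c) ->
      (forall a b, [\/ lt a b, a = b | lt b a]) ->
      forall P : W -> (X -> R) -> \bar R, pi_family lt P ->
      forall (w : W) (f : X -> R), dual_ball f -> (P w f < +oo)%E in
  [/\ condi <-> condii, condii <-> condiii & condiii <-> condiv].
Proof.
move=> condi condii condiii condiv; have [d dd] := separable_dense_seq sepX.
have i_ii : condi -> condii.
  move=> [T [Tl [T0 [c [C [c0 [C0 cC]]]]]]].
  have Tln (a : R) x y n : T (a *: x + y) n = a * T x n + T y n by rewrite Tl.
  have TC x n : `|T x n| <= C * `|x|.
    apply: le_trans (cC x).2; apply: ub_le_sup; last by exists n.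
    exact: cvg0_has_ubound.
  have Tc x : c * `|x| <= sup (range (fun n => `|T x n|)) := (cC x).1.
  exists (fun f => C * c0_norm T f); split.
    by exists (C / c) => f fB; exact: (c0_norm_bounded Tln c0 C0 Tc TC fB).
  exact: lkk_liminf_growth (c0_norm_lkk dd Tln T0 c0 C0 Tc TC).
have ii_i : condii -> condi.
  move=> [mu [[M muM] /(liminf_growth_lkk dd) mu_lkk]].
  have [N [S [N4 SB Nmu Spath]]] := lkk_nets mu_lkk.
  exists (net_embedding d S); split; first exact: (net_embedding_linear d SB).
  split; first exact: (net_embedding_c0 dd SB).
  have M0 : 0 <= M by apply: le_trans (muM _ (dual_ball0 X)).
  have M5 : 0 < 5 + 2 * M by lra.
  exists (5 + 2 * M)^-1, 1; split; first by rewrite invr_gt0.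
  split=> // x; split.
    by rewrite ler_pdivrMl //; exact: (net_embedding_ge dd muM N4 SB Nmu Spath).
  rewrite mul1r; apply: ge_sup; first by exists `|net_embedding d S x 0%N|, 0%N.
  by move=> _ [n _ <-]; exact: (net_embedding_le d SB).
have ii_iii : condii -> condiii.
  move=> [mu [[M muM] /(liminf_growth_lkk dd) mu_lkk]].
  exists (fun f => - 2 * mu f); split; last exact/pi_superP/(lkk_pi_super mu_lkk).
  by exists (2 * M) => f fB; rewrite normrM normrN normr_nat ler_pM2l ?muM.
have iii_ii : condiii -> condii.
  move=> [pi [[M piM] /pi_superP piS]]; exists (fun f => - pi f); split.
    by exists M => f /piM; rewrite normrN.
  exact: lkk_liminf_growth (pi_super_lkk dd piS).
have iii_iv : condiii -> condiv.
  move=> [pi [[M piM] /pi_superP piS]] W lt wf tr tot P fam w f fB.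
  apply: le_lt_trans (pi_family_le piS piM wf tr tot fam w fB) _; exact: ltry.
have iv_iii : condiv -> condiii.
  move=> H; have [|pi [piM piS]] := pi_super_of_stages dd.
    move=> [W w] f fB; apply: (H W _ (@wo_wf W) (@wo_trans W) (@wo_total W)) => //.
    exact: (pi_iter_family _ (@wo_trans W) (@wo_total W)).
  by exists pi; split=> //; exact/pi_superP.
by split; split.
Qed.
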